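(* Let $\alpha>0$. Let $\{d_n\}_{n\ge1}$ and $\{b_n\}_{n\ge1}$ be real random variables on a common probability space, all of them (jointly) independent, and suppose there is a sequence of real numbers $\{m_k\}_{k\ge0}$ with $m_0=1$ such that $$\lim_{n\to\infty}\mathbb{E}\left[(b_n/n^{\alpha})^k\right]=m_k\quad\text{for every integer }k\ge0,$$ and $$\sup_{n\ge1}\mathbb{E}\left[|d_n|^k\right]<\infty\quad\text{for every integer }k\ge0.$$ Let $A_n$ be the symmetric tridiagonal $n\times n$ matrix built from $d_1,\dots,d_n$ and $b_1,\dots,b_{n-1}$ as described in the context, and let $X_n=n^{-\alpha}A_n$. Then $$\lim_{n\to\infty}\mathbb{E}\left[\mathrm{tr}_n(X_n^k)\right]=L_k\quad\text{for every }k\ge0,$$ and, almost surely, $$\lim_{n\to\infty}\mathrm{tr}_n(X_n^k)=L_k\quad\text{for every }k\ge0,$$ where $$L_k=\begin{cases}0,& k\text{ odd},\\[2pt] \dfrac{1}{\alpha k+1}\displaystyle\sum_{\gamma\in\Gamma_k}\ \prod_{i<0}m_{\mathbbm{l}_i(\gamma)},& k\text{ even}.\end{cases}$$ Here $\mathbbm{l}_i(\gamma)$ and $\Gamma_k$ are defined in the context.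
   Context: Matrix model: $A_n$ is the $n\times n$ symmetric tridiagonal matrix whose diagonal entries, from top to bottom, are $d_n,d_{n-1},\dots,d_1$ and whose entries directly above (and below) the diagonal, from top to bottom, are $b_{n-1},b_{n-2},\dots,b_1$; all other entries are $0$. All moments of the variables $b_n,d_n$ that appear are understood to be finite. All the matrices $A_n$, $n\ge1$, are built from the same two sequences. Normalized trace: $\mathrm{tr}_n(Y)=\frac1n\sum_{i=1}^n y_{i,i}$ for an $n\times n$ matrix $Y=(y_{i,j})$. Paths: for $k\ge1$, $\Gamma_k$ is the set of all $\gamma=(j_1,j_2,\dots,j_{k+1})\in\mathbb{Z}^{k+1}$ with $j_1=j_{k+1}$, $|j_u-j_{u+1}|=1$ for $1\le u\le k$, and $\max_u j_u=0$. For $k=0$, $\Gamma_0=\{(0)\}$ (so $L_0=1$). For a path $\gamma$ and $i\in\mathbb{Z}$, $\mathbbm{l}_i(\gamma)$ is the number of crossings of $\gamma$ with the line $y=i+1/2$, i.e. the number of $u\in\{1,\dots,k\}$ with $\{j_u,j_{u+1}\}=\{i,i+1\}$. Since $m_0=1$, only finitely many factors in the products $\prod_{i<0}$ differ from $1$. *)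

(* Defs.v *)
From HB Require Import structures.
From mathcomp Require Import all_boot all_order all_algebra finmap.
From mathcomp Require Import all_classical all_reals all_analysis.
From mathcomp Require Import zify.

Set Implicit Arguments.
Unset Strict Implicit.
Unset Printing Implicit Defensive.

Import Order.TTheory GRing.Theory Num.Theory.
Import numFieldNormedType.Exports.

Local Open Scope classical_set_scope.
Local Open Scope ring_scope.

(* Joint independence of the real random variables X i, i in D: the product
   rule for every finite subfamily and all Borel sets. *)
Definition independent_RVs {disp : measure_display} {T : measurableType disp}
    {R : realType} (P : probability T R) (I : choiceType) (D : set I)
    (X : I -> {RV P >-> R}) : Prop :=
  forall (J : {fset I}) (B : I -> set R),
    [set` J] `<=` D -> (forall i, i \in J -> measurable (B i)) ->
    P (\bigcap_(i in [set` J]) (X i @^-1` B i))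
    = (\prod_(i <- J) P (X i @^-1` B i))%E.

(* Rows and columns are numbered from 0 while d and b are used from index 1
   on: the diagonal reads d n, ..., d 1 and the entry in position (i, i+1)
   is b (n - 1 - i), so that b (n - 1), ..., b 1 lie above the diagonal. *)
Definition tridiag {R : realType} (d b : nat -> R) (n : nat) : 'M[R]_n :=
  \matrix_(i < n, j < n)
    if i == j then d (n - i)%N
    else if j == i.+1 :> nat then b (n - 1 - i)%N
    else if i == j.+1 :> nat then b (n - 1 - j)%N
    else 0.

Definition ntrace {R : realType} (n : nat) (Y : 'M[R]_n) : R := n%:R^-1 * \tr Y.

(* A path (j_1, ..., j_{k+1}) is the function on 'I_k.+1 mapping u to j_{u+1};
   its steps are indexed by u : 'I_k. *)
Definition step_src {k : nat} (g : {ffun 'I_k.+1 -> int}) (u : 'I_k) : int :=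
  g (widen_ord (leqnSn k) u).

Definition step_tgt {k : nat} (g : {ffun 'I_k.+1 -> int}) (u : 'I_k) : int :=
  g (lift ord0 u).

(* For k = 0 this is the singleton of the constant path 0. *)
Definition Gamma (k : nat) : set {ffun 'I_k.+1 -> int} :=
  [set g : {ffun 'I_k.+1 -> int} |
           [/\ g ord0 = g ord_max,
               forall u : 'I_k, `|step_src g u - step_tgt g u| = 1,
               forall u : 'I_k.+1, g u <= 0
             & exists u : 'I_k.+1, g u = 0]].
Arguments Gamma k : clear implicits.

Definition crossings {k : nat} (g : {ffun 'I_k.+1 -> int}) (i : int) : nat :=
  #|[set u : 'I_k | ((step_src g u == i) && (step_tgt g u == i + 1))
                 || ((step_src g u == i + 1) && (step_tgt g u == i))]%SET|.

(* Both big operators range over infinite types with finite support: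
   Gamma k is finite (finite_Gamma), and so is the set of the i with
   crossings g i != 0 (finite_crossings), outside of which the factor is
   m 0 = 1. *)
Definition limit_moment {R : realType} (alpha : R) (m : nat -> R) (k : nat) : R :=
  if odd k then 0
  else (alpha * k%:R + 1)^-1 *
       \sum_(g \in Gamma k)
          \big[*%R/1]_(i \in [set i : int | i < 0]) m (crossings g i).

Lemma Gamma0 : Gamma 0 = [set [ffun=> 0]].
Proof.
apply/seteqP; split=> g /=.
  move=> [_ _ _ [u gu]]; apply/ffunP => v.
  by rewrite ffunE (ord1 v) -(ord1 u).
move=> ->; split; rewrite ?ffunE //.
- by case.
- by move=> u; rewrite ffunE.
- by exists ord0; rewrite ffunE.
Qed.

Lemma finite_Gamma (k : nat) : finite_set (Gamma k).
Proof.
pose F (f : {ffun 'I_k.+1 -> 'I_(k + k).+1}) : {ffun 'I_k.+1 -> int} :=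
  [ffun u => - (f u)%:Z].
apply: (@sub_finite_set _ _ (F @` setT)); last exact: finite_image.
move=> g [_ stepg gle0 [u0 gu0]].
have bnd (v : nat) (hv : (v < k.+1)%N) :
    `|g ord0 - g (Ordinal hv)| <= v%:Z.
  elim: v hv => [|v IH] hv.
    by rewrite (_ : Ordinal hv = ord0) ?subrr ?normr0//; exact: val_inj.
  have hv' : (v < k)%N by [].
  have := stepg (Ordinal hv'); rewrite /step_src /step_tgt.
  have -> : widen_ord (leqnSn k) (Ordinal hv') = Ordinal (ltnW hv : (v < k.+1)%N)
    by exact: val_inj.
  have -> : lift ord0 (Ordinal hv') = Ordinal hv by exact: val_inj.
  move: (IH (ltnW hv)); set a := g ord0; set x := g _; set y := g _.
  move=> le_axv xy1.
  rewrite (_ : a - y = (a - x) + (x - y)); last by rewrite addrA subrK.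
  by apply: (le_trans (ler_normD _ _)); rewrite xy1; lia.
have gbnd v : - (k + k)%:Z <= g v.
  have := bnd u0 (ltn_ord u0); have := bnd v (ltn_ord v).
  have -> : Ordinal (ltn_ord u0) = u0 by exact: val_inj.
  have -> : Ordinal (ltn_ord v) = v by exact: val_inj.
  have := ltn_ord u0; have := ltn_ord v; have := gle0 v; rewrite gu0.
  by lia.
exists [ffun u => inord `|g u|%N] => //.
apply/ffunP => u; rewrite !ffunE inordK.
  by rewrite lez0_abs ?opprK.
by have := gbnd u; rewrite lerNl -lez0_abs.
Qed.

Lemma finite_crossings (k : nat) (g : {ffun 'I_k.+1 -> int}) :
  finite_set [set i : int | crossings g i != 0%N].
Proof.
apply: (@sub_finite_set _ _
  (step_src g @` setT `|` step_tgt g @` setT)); last first.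
  by rewrite finite_setU; split; exact: finite_image.
move=> i /=; rewrite /crossings cards_eq0 => /set0Pn[u]; rewrite inE.
by case/orP => /andP[/eqP h /eqP h']; [left|right]; exists u.
Qed.

(* Main.v *)
Require Import Defs.
From HB Require Import structures.
From mathcomp Require Import all_boot all_order all_algebra finmap.
From mathcomp Require Import all_classical all_reals all_analysis measurable_realfun.
From mathcomp Require Import zify ring lra.

Set Implicit Arguments.
Unset Strict Implicit.
Unset Printing Implicit Defensive.

Import Order.TTheory GRing.Theory Num.Theory.
Import numFieldNormedType.Exports.

Local Open Scope classical_set_scope.
Local Open Scope ring_scope.

(** The largest position of a closed walk organizes the proof. Expanding
    tr (A_n ^ k) over closed walks of length k in 1, ..., n, with the diagonal
    entry d_p as weight of a flat step at p and b_q as weight of a step between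
    q and q + 1, and sorting the walks by their maximum, gives
      tr (A_n ^ k) = Y_1 + ... + Y_n,
    where Y_j collects the closed walks with maximum j that stay above 0
    (mxtrace_tridiag_pow). Because the entries of A_n are numbered from the
    bottom right corner, Y_j does not depend on n: the traces are the partial
    sums of one random sequence.

    Three properties of this sequence are needed. First, Y_j involves only
    variables with index within distance 2k of j, so Y_i and Y_j are
    uncorrelated for |i - j| > 2k (expectation_peak_sum_mul). Second,
    E (Y_j ^ 2) = O(j ^ (2 alpha k)), as there are boundedly many walks and each
    entry has moments of order at most j ^ alpha (peak_sum_sqr_le). Third,
    E (Y_j) / j ^ (alpha k) converges (peak_sum_mean_lim): by independence the
    expected weight of a walk is the product over its distinct edges of moments
    E (b_q ^ c) or E (d_q ^ c), where c counts the uses of the edge. After the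
    normalization the former tends to m_c, because q / j tends to 1, and the
    latter to 0, because the d_q do not grow. So only walks without flat steps
    survive; translated to have maximum 0 they are the paths of Gamma_k, the
    numbers c are their crossing numbers, and there are none for odd k
    (GammaE, limit_momentE).

    Any sequence with these three properties obeys a strong law
    (strong_law_polynomial_growth): (Y_1 + ... + Y_n) / n ^ (alpha k + 1) tends to
    lim E (Y_j) / j ^ (alpha k), divided by alpha k + 1, both in mean and almost
    surely. The mean is a Stolz-Cesaro argument. For the almost sure limit the
    variance of the normalized sum is O(1/n), which is summable along the
    squares n = l ^ 2, and the 2 l + 1 terms between consecutive squares are
    too few to matter.

    The factorization of expectations is derived from the product rule for
    events, passing from indicators to nonnegative and then to integrable
    functions of one variable at a time (expectation_prod). *)

(** * Finite sums of integrable functions *)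

Section finite_sums.
Context {d} {T : measurableType d} {R : realType}
  (mu : {measure set T -> \bar R}).

Lemma integrable_scale (c : R) (f : T -> R) :
  mu.-integrable setT (fun w => (f w)%:E) ->
  mu.-integrable setT (fun w => (c * f w)%:E).
Proof. by move=> intf; under eq_fun do rewrite EFinM; exact: integrableZl. Qed.

Lemma integrable_add (f g : T -> R) :
  mu.-integrable setT (fun w => (f w)%:E) ->
  mu.-integrable setT (fun w => (g w)%:E) ->
  mu.-integrable setT (fun w => (f w + g w)%:E).
Proof.
by move=> intf intg; under eq_fun do rewrite EFinD; exact: integrableD.
Qed.

Lemma integrable_bigsum (I : Type) (s : seq I) (Q : pred I) (f : I -> T -> R) :
  (forall i, Q i -> mu.-integrable setT (fun w => (f i w)%:E)) ->
  mu.-integrable setT (fun w => (\sum_(i <- s | Q i) f i w)%:E).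
Proof.
move=> intf.
under eq_fun do rewrite -sumEFin.
exact: integrable_sum.
Qed.

Lemma Rintegral_sum (I : Type) (s : seq I) (Q : pred I) (f : I -> T -> R) :
  (forall i, Q i -> mu.-integrable setT (fun w => (f i w)%:E)) ->
  \int[mu]_w (\sum_(i <- s | Q i) f i w) = \sum_(i <- s | Q i) \int[mu]_w f i w.
Proof.
move=> intf; elim: s => [|i s IH].
  by under eq_Rintegral do rewrite big_nil; rewrite big_nil Rintegral_cst// mul0r.
rewrite big_cons; case: ifPn => Qi; last first.
  by rewrite -IH; apply: eq_Rintegral => w _; rewrite big_cons (negbTE Qi).
rewrite -IH -RintegralD//; last 2 first.
- exact: intf.
- exact: integrable_bigsum.
by apply: eq_Rintegral => w _; rewrite big_cons Qi.
Qed.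

End finite_sums.

(** * Expectations of products of independent variables *)

Section indicator_to_nonnegative.
Import HBNNSimple.

(** Both sides are linear in f, so the identity passes from indicators to
    simple functions, and monotone convergence along simple approximations
    carries it to f. Finiteness of the integral of G lets the limit be taken
    inside the product on the right. *)
Lemma integral_mul_of_indic {d} {T : measurableType d} {R : realType}
    (P : probability T R) (U : {RV P >-> R}) (G : T -> R)
    (mG : measurable_fun setT G) (G0 : forall w, 0 <= G w)
    (finG : (\int[P]_w (G w)%:E)%E \is a fin_num)
    (indic : forall B, measurable B ->
       (\int[P]_w ((\1_B (U w) : R) * G w)%:E
        = (\int[P]_w (\1_B (U w) : R)%:E) * \int[P]_w (G w)%:E)%E)
    (f : R -> R) (mf : measurable_fun setT f) (f0 : forall x, 0 <= f x) :
  (\int[P]_w (f (U w) * G w)%:E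
     = (\int[P]_w (f (U w))%:E) * \int[P]_w (G w)%:E)%E.
Proof.
have mEf : measurable_fun setT (fun x => (f x)%:E) by exact/measurable_EFinP.
pose h := nnsfun_approx measurableT mEf.
have hf x : (h n x)%:E @[n --> \oo] --> (f x)%:E.
  by apply: (@cvg_nnsfun_approx _ _ _ setT measurableT _ mEf) => // y _; rewrite lee_fin.
have mhU n : measurable_fun setT (fun w => h n (U w)).
  exact: measurableT_comp.
have mh1 n r : measurable_fun setT (fun w => (r * \1_(h n @^-1` [set r]) (U w))%R).
  apply: measurable_funM => //.
  by apply: (measurableT_comp (f := \1_(h n @^-1` [set r]) : R -> R)) => //.
have r0 n r : range (h n) r -> (0 <= r)%R by move=> [x _ <-].
have ind0 n r w : (0 <= r * \1_(h n @^-1` [set r]) (U w))%R.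
  have [<-|hr] := pselect (h n (U w) = r); first by rewrite mulr_ge0.
  by rewrite indicE memNset ?mulr0.
have simpleG n : (\int[P]_w (h n (U w) * G w)%:E
     = (\int[P]_w (h n (U w))%:E) * \int[P]_w (G w)%:E)%E.
  transitivity (\int[P]_w (\sum_(r \in range (h n))
      (r * \1_(h n @^-1` [set r]) (U w) * G w)%:E))%E.
    apply: eq_integral => w _; rewrite fsumEFin//; congr EFin.
    by rewrite [in LHS]fimfunE -mulr_fsuml.
  rewrite ge0_integral_fsum//=; last 2 first.
  - by move=> r; apply/measurable_EFinP; apply: measurable_funM.
  - by move=> r w _; rewrite lee_fin mulr_ge0.
  transitivity ((\int[P]_w (\sum_(r \in range (h n))
      (r * \1_(h n @^-1` [set r]) (U w))%:E) * \int[P]_w (G w)%:E)%E); last first.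
    congr (_ * _)%E; apply: eq_integral => w _; rewrite fsumEFin//; congr EFin.
    by rewrite [in RHS]fimfunE.
  rewrite ge0_integral_fsum//=; last 2 first.
  - by move=> r; apply/measurable_EFinP.
  - by move=> r w _; rewrite lee_fin.
  rewrite ge0_mule_fsuml; last first.
    by move=> r; apply: integral_ge0 => w _; rewrite lee_fin.
  apply: eq_fsbigr => r /[!inE] /r0 rge0.
  under eq_integral do rewrite -mulrA EFinM.
  rewrite ge0_integralZl//; last 2 first.
  - apply/measurable_EFinP; apply: measurable_funM => //.
    exact: (measurableT_comp (f := \1_(h n @^-1` [set r]) : R -> R)).
  - by move=> w _; rewrite lee_fin mulr_ge0//.
  rewrite indic// muleA; congr (_ * _)%E.
  under [RHS]eq_integral do rewrite EFinM.
  rewrite ge0_integralZl//.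
  apply/measurable_EFinP.
  exact: (measurableT_comp (f := \1_(h n @^-1` [set r]) : R -> R)).
have nd x : {homo (fun n => (h n x)%:E) : a b / (a <= b)%N >-> (a <= b)%E}.
  by move=> a b ab; rewrite lee_fin; exact/lefP/nd_nnsfun_approx.
have cvl : (\int[P]_w (h n (U w) * G w)%:E @[n --> \oo] -->
    \int[P]_w (f (U w) * G w)%:E)%E.
  rewrite [X in _ --> X](_ : _ = \int[P]_w limn (fun n => (h n (U w) * G w)%:E))%E.
    apply: cvg_monotone_convergence => //.
    + by move=> n; apply/measurable_EFinP/measurable_funM.
    + by move=> n w _; rewrite lee_fin mulr_ge0//.
    + move=> w _ a b ab; rewrite lee_fin ler_wpM2r// -lee_fin; exact: nd.
  apply: eq_integral => w _; apply/esym/cvg_lim => //.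
  rewrite EFinM; under eq_fun do rewrite EFinM.
  by apply: cvgeZr => //; exact: hf.
have cvr : (\int[P]_w (h n (U w))%:E @[n --> \oo] -->
    \int[P]_w (f (U w))%:E)%E.
  rewrite [X in _ --> X](_ : _ = \int[P]_w limn (fun n => (h n (U w))%:E))%E.
    apply: cvg_monotone_convergence => //.
    + by move=> n; apply/measurable_EFinP.
    + by move=> n w _; rewrite lee_fin.
  by apply: eq_integral => w _; apply/esym/cvg_lim => //; exact: hf.
rewrite (funext simpleG) in cvl.
apply: (cvg_unique _ cvl); first exact: ereal_hausdorff.
exact: cvgeZr.
Qed.

End indicator_to_nonnegative.

Section independent_product.
Context {d} {T : measurableType d} {R : realType} (P : probability T R).
Context (I : choiceType) (D : set I) (X : I -> {RV P >-> R}).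
Hypothesis indep : independent_RVs D X.
Variable J : {fset I}.
Hypothesis JD : [set` J] `<=` D.

Lemma measurable_prod_family (phi : I -> R -> R) (s : seq I) (Q : pred I) :
  (forall i, measurable_fun setT (phi i)) ->
  measurable_fun setT (fun w => \prod_(i <- s | Q i) phi i (X i w)).
Proof.
move=> mphi; elim: s => [|i s IH].
  under eq_fun do rewrite big_nil.
  exact: measurable_cst.
under eq_fun do rewrite big_cons.
by case: (Q i) => //; apply: measurable_funM => //; exact: (measurableT_comp (mphi i)).
Qed.

Lemma integral_indic_comp (U : {RV P >-> R}) (B : set R) : measurable B ->
  (\int[P]_w (\1_B (U w) : R)%:E = P (U @^-1` B))%E.
Proof.
move=> mB; rewrite -[in RHS](setIT (U @^-1` B)).
rewrite -integral_indic//; exact: measurable_funPTI.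
Qed.

(** A product of indicators is the indicator of an intersection, so this is
    the product rule for events. *)
Lemma expectation_prod_indic (B : I -> set R) :
  (forall i, i \in J -> measurable (B i)) ->
  (\int[P]_w (\prod_(i <- J) (\1_(B i) (X i w) : R))%:E
     = \prod_(i <- J) \int[P]_w (\1_(B i) (X i w) : R)%:E)%E.
Proof.
move=> mB; have mXB i : i \in J -> measurable (X i @^-1` B i).
  by move=> iJ; apply: measurable_funPTI => //; exact: mB.
transitivity (P (\bigcap_(i in [set` J]) (X i @^-1` B i))).
  rewrite -[in RHS](setIT (\bigcap_(i in _) _)) -integral_indic//; last first.
    by apply: fin_bigcap_measurable => // i iJ; exact: mXB.
  apply: eq_integral => w _; congr EFin.
  have [wB|wB] := pselect ((\bigcap_(i in [set` J]) (X i @^-1` B i)) w).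
    rewrite indicE mem_set// big_seq big1// => i iJ.
    by rewrite indicE mem_set//; exact: wB.
  rewrite indicE memNset//; move/existsNP: wB => [i /not_implyP[/= iJ wi]].
  by rewrite (bigD1_seq i)//= indicE memNset ?mul0r.
rewrite indep// big_seq [RHS]big_seq; apply: eq_bigr => i iJ.
by rewrite integral_indic_comp//; exact: mB.
Qed.

(** The list s contains the indices whose function may still be arbitrary; the
    induction on s fixes the head i of s. Replacing phi i by an indicator is
    covered by the induction hypothesis, and integral_mul_of_indic undoes the
    replacement. *)
Lemma expectation_prod_ge0 (phi : I -> R -> R) (s : seq I) :
  (forall i, measurable_fun setT (phi i)) -> (forall i x, 0 <= phi i x) ->
  (forall i, i \in J -> i \notin s ->
     exists2 B, measurable B & phi i = \1_B) ->
  (forall i, i \in J -> (\int[P]_w (phi i (X i w))%:E)%E \is a fin_num) ->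
  (\int[P]_w (\prod_(i <- J) phi i (X i w))%:E
     = \prod_(i <- J) \int[P]_w (phi i (X i w))%:E)%E.
Proof.
elim: s phi => [|i s IH] phi mphi phi0 indic finphi.
  have /choice [B BP] : forall i, exists B, i \in J -> measurable B /\ phi i = \1_B.
    move=> i; case: (boolP (i \in J)) => iJ; last by exists set0.
    by have [//|B mB e] := indic i iJ; exists B.
  have mB i : i \in J -> measurable (B i) by move=> /BP[].
  have := expectation_prod_indic mB.
  rewrite big_seq; under eq_bigr => i iJ do rewrite -(BP i iJ).2.
  rewrite -big_seq => <-; apply: eq_integral => w _; congr EFin.
  by rewrite big_seq [RHS]big_seq; apply: eq_bigr => i /BP[_ ->].
have [iJ|iJ] := boolP (i \in J); last first.
  apply: IH => // j jJ js; apply: indic => //.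
  by rewrite inE negb_or js andbT; apply: contraNneq iJ => <-.
pose G w := \prod_(j <- J | j != i) phi j (X j w).
have upd B : measurable B ->
    ((\int[P]_w ((\1_B (X i w) : R) * G w)%:E
        = (\int[P]_w (\1_B (X i w) : R)%:E) *
          \prod_(j <- J | j != i) \int[P]_w (phi j (X j w))%:E)%E).
  move=> mB; pose psi j := if j == i then (\1_B : R -> R) else phi j.
  have psii : psi i = \1_B by rewrite /psi eqxx.
  have psij j : j != i -> psi j = phi j by rewrite /psi => /negbTE ->.
  have mpsi j : measurable_fun setT (psi j).
    by have [->|/psij->//] := eqVneq j i; rewrite psii.
  have psi0 j x : 0 <= psi j x.
    by have [->|/psij->//] := eqVneq j i; rewrite psii indicE.
  have ipsi j : j \in J -> j \notin s -> exists2 B, measurable B & psi j = \1_B.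
    move=> jJ js; have [->|ji] := eqVneq j i; first by rewrite psii; exists B.
    by rewrite psij//; apply: indic => //; rewrite inE negb_or ji.
  have fpsi j : j \in J -> (\int[P]_w (psi j (X j w))%:E)%E \is a fin_num.
    have [->|/psij->] := eqVneq j i; last exact: finphi.
    by rewrite psii integral_indic_comp// fin_num_measure//; exact: measurable_funPTI.
  have := IH psi mpsi psi0 ipsi fpsi.
  rewrite [in RHS](bigD1_seq i)//= psii.
  rewrite [in RHS](eq_bigr (fun j => \int[P]_w (phi j (X j w))%:E)%E); last first.
    by move=> j ji; rewrite psij.
  move=> <-; apply: eq_integral => w _; congr EFin.
  rewrite (bigD1_seq i)//= psii; congr (_ * _).
  by apply: eq_bigr => j ji; rewrite psij.
have EG : (\int[P]_w (G w)%:E = \prod_(j <- J | j != i) \int[P]_w (phi j (X j w))%:E)%E.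
  have := upd setT measurableT.
  rewrite integral_indic_comp// preimage_setT probability_setT mul1e => <-.
  by apply: eq_integral => w _; rewrite indicT mul1r.
rewrite [RHS](bigD1_seq i)//= -EG.
rewrite -(integral_mul_of_indic (U := X i)) //.
- by apply: eq_integral => w _; rewrite (bigD1_seq i).
- exact: measurable_prod_family.
- by move=> w; apply: prodr_ge0.
- by rewrite EG big_seq_cond; apply: prode_fin_num => j /andP[jJ _]; exact: finphi.
- by move=> B mB; rewrite EG upd.
Qed.

(** The absolute values form a nonnegative family, so the integral of their
    product is a product of finite numbers. *)
Lemma integrable_prod (phi : I -> R -> R) :
  (forall i, measurable_fun setT (phi i)) ->
  (forall i, i \in J -> P.-integrable setT (fun w => (phi i (X i w))%:E)) ->
  P.-integrable setT (fun w => (\prod_(i <- J) phi i (X i w))%:E).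
Proof.
move=> mphi iphi; apply/integrableP; split.
  exact/measurable_EFinP/measurable_prod_family.
have finphi i : i \in J -> (\int[P]_w (`|phi i (X i w)|)%:E)%E \is a fin_num.
  move=> iJ; rewrite ge0_fin_numE; last by apply: integral_ge0 => w _; rewrite lee_fin.
  by have /integrableP[_] := iphi i iJ.
under eq_integral do rewrite abse_EFin normr_prod.
have := @expectation_prod_ge0 (fun i x => `|phi i x|) J.
move=> ->//; first by rewrite ltey_eq big_seq prode_fin_num// => i /finphi.
- by move=> i; exact: measurableT_comp.
- by move=> i iJ; rewrite iJ.
Qed.

(** Signs are removed one index at a time: phi i is the difference of its
    positive and negative parts, and both sides are linear in phi i. The list
    s of the induction contains the indices whose function may change sign. *)
Lemma expectation_prod (phi : I -> R -> R) :
  (forall i, measurable_fun setT (phi i)) ->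
  (forall i, i \in J -> P.-integrable setT (fun w => (phi i (X i w))%:E)) ->
  \int[P]_w (\prod_(i <- J) phi i (X i w)) = \prod_(i <- J) \int[P]_w phi i (X i w).
Proof.
suff H (s : seq I) : forall phi : I -> R -> R,
  (forall i, measurable_fun setT (phi i)) ->
  (forall i, i \in J -> P.-integrable setT (fun w => (phi i (X i w))%:E)) ->
  (forall i x, i \in J -> i \notin s -> 0 <= phi i x) ->
  \int[P]_w (\prod_(i <- J) phi i (X i w)) = \prod_(i <- J) \int[P]_w phi i (X i w).
  by move=> mphi iphi; apply: (H J) => // i x ->.
elim: s => [|i s IH] {}phi mphi iphi phi0.
  pose psi i x := `|phi i x|.
  have psiE i x : i \in J -> phi i x = psi i x.
    by move=> iJ; rewrite /psi ger0_norm// phi0.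
  have finpsi i : i \in J -> (\int[P]_w (psi i (X i w))%:E)%E \is a fin_num.
    move=> iJ; under eq_integral do rewrite -psiE//.
    by apply: integrable_fin_num => //; exact: iphi.
  transitivity (fine (\int[P]_w (\prod_(i <- J) psi i (X i w))%:E)).
    congr fine; apply: eq_integral => w _; congr EFin.
    by rewrite big_seq [RHS]big_seq; apply: eq_bigr => i /psiE.
  rewrite (@expectation_prod_ge0 psi J)//; last 3 first.
  - by move=> i; exact: (measurableT_comp (@normr_measurable R setT) (mphi i)).
  - by move=> i x; exact: normr_ge0.
  - by move=> i iJ; rewrite iJ.
  rewrite big_seq [RHS]big_seq.
  rewrite (eq_bigr (fun i => (\int[P]_w phi i (X i w))%:E)).
    by rewrite prodEFin.
  move=> i iJ; rewrite fineK; last exact: integrable_fin_num (iphi i iJ).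
  by under [in LHS]eq_integral do rewrite -psiE//.
have [iJ|iJ] := boolP (i \in J); last first.
  apply: IH => // j x jJ js; apply: phi0 => //.
  by rewrite inE negb_or js andbT; apply: contraNneq iJ => <-.
pose upd (f : R -> R) j := if j == i then f else phi j.
have updi f : upd f i = f by rewrite /upd eqxx.
have updj f j : j != i -> upd f j = phi j by rewrite /upd => /negbTE ->.
have iupd f : P.-integrable setT (fun w => (f (X i w))%:E) ->
    forall j, j \in J -> P.-integrable setT (fun w => (upd f j (X j w))%:E).
  move=> intf j jJ; have [->|ji] := eqVneq j i; first by rewrite updi.
  by rewrite updj//; exact: iphi.
have mupd (f : R -> R) : measurable_fun setT f -> forall j, measurable_fun setT (upd f j).
  by move=> mf j; have [->|ji] := eqVneq j i; rewrite ?updi// updj.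
have prodE f w : \prod_(j <- J) upd f j (X j w) =
    f (X i w) * \prod_(j <- J | j != i) phi j (X j w).
  rewrite (bigD1_seq i)//= updi; congr (_ * _).
  by apply: eq_bigr => j ji; rewrite updj.
have IHf (f : R -> R) : measurable_fun setT f -> (forall x, 0 <= f x) ->
   P.-integrable setT (fun w => (f (X i w))%:E) ->
   P.-integrable setT (fun w => (f (X i w) * \prod_(j <- J | j != i) phi j (X j w))%:E)
   /\ \int[P]_w (f (X i w) * \prod_(j <- J | j != i) phi j (X j w)) =
   \int[P]_w f (X i w) * \prod_(j <- J | j != i) \int[P]_w phi j (X j w).
  move=> mf f0 intf; split.
    under eq_fun do rewrite -prodE.
    by apply: integrable_prod; [exact: mupd|exact: iupd].
  under eq_Rintegral do rewrite -prodE.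
  rewrite IH; [|exact: mupd|exact: iupd|].
    rewrite (bigD1_seq i)//= updi; congr (_ * _).
    by apply: eq_bigr => j ji; rewrite updj.
  move=> j x jJ js; have [->|ji] := eqVneq j i; first by rewrite updi.
  by rewrite updj// phi0// inE negb_or ji.
have [ip Ep] := IHf ((phi i)^\+)%R (measurable_funrpos (mphi i)) (@funrpos_ge0 _ _ _)
   (@integrable_funrpos _ _ _ P _ (phi i \o X i) measurableT (iphi i iJ)).
have [in_ En] := IHf ((phi i)^\-)%R (measurable_funrneg (mphi i)) (@funrneg_ge0 _ _ _)
   (@integrable_funrneg _ _ _ P _ (phi i \o X i) measurableT (iphi i iJ)).
rewrite (bigD1_seq i)//=.
transitivity (\int[P]_w ((phi i)^\+ (X i w) * \prod_(j <- J | j != i) phi j (X j w)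
   - (phi i)^\- (X i w) * \prod_(j <- J | j != i) phi j (X j w))).
  apply: eq_Rintegral => w _; rewrite (bigD1_seq i)//= -mulrBl; congr (_ * _).
  by rewrite -[in LHS](funrposBneg (phi i)).
rewrite RintegralB// Ep En -mulrBl -RintegralB//; last 2 first.
  exact: (@integrable_funrpos _ _ _ P _ (phi i \o X i) measurableT (iphi i iJ)).
  exact: (@integrable_funrneg _ _ _ P _ (phi i \o X i) measurableT (iphi i iJ)).
congr (_ * _); apply: eq_Rintegral => w _.
by rewrite -[in RHS](funrposBneg (phi i)).
Qed.

End independent_product.

(** * Almost sure convergence from summable expectations *)

Lemma cvg0_of_nneseries_fin {R : realType} (u : nat -> R) :
  (forall n, 0 <= u n) -> (\sum_(n <oo) (u n)%:E < +oo)%E ->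
  u n @[n --> \oo] --> 0.
Proof.
move=> u0 ulty; apply: cvg_series_cvg_0.
have sfin : (\sum_(n <oo) (u n)%:E)%E \is a fin_num.
  by rewrite ge0_fin_numE//; apply: nneseries_ge0 => n _ _; rewrite lee_fin.
apply: nondecreasing_is_cvgn; first exact: nondecreasing_series.
exists (fine (\sum_(n <oo) (u n)%:E)%E) => _ [n _ <-].
rewrite -lee_fin fineK// /series /= -sumEFin.
by apply: nneseries_lim_ge => k _ _; rewrite lee_fin.
Qed.

Lemma sum_invr_sqr_le {R : realType} (n : nat) :
  \sum_(0 <= l < n) (l.+1%:R ^+ 2)^-1 <= 2 :> R.
Proof.
case: n => [|n]; first by rewrite big_geq.
(* The bound 2 - 1 / (n + 1) is inductive because
   1 / (x + 1) ^ 2 <= 1 / x - 1 / (x + 1). *)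
suff /le_trans-> : \sum_(0 <= l < n.+1) (l.+1%:R ^+ 2)^-1 <= 2 - n.+1%:R^-1 :> R => //.
  by rewrite lerBlDr lerDl invr_ge0 ler0n.
elim: n => [|n IH]; first by rewrite big_nat1 invr1 expr1n invr1; lra.
rewrite big_nat_recr//=.
apply: (le_trans (lerD IH (lexx _))).
have n0 : 0 < n.+1%:R :> R by rewrite ltr0n.
have -> : n.+2%:R = n.+1%:R + 1 :> R by rewrite natr1.
set x := n.+1%:R in n0 *.
rewrite -subr_ge0.
suff -> : 2 - (x + 1)^-1 - (2 - x^-1 + ((x + 1) ^+ 2)^-1) = (x * (x + 1) ^+ 2)^-1.
  by rewrite invr_ge0 mulr_ge0 ?sqr_ge0 ?ltW.
by field; apply/andP; split; apply/eqP; lra.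
Qed.

(** By monotone convergence the series of the f n has a finite integral, so it
    converges almost everywhere, and then its terms tend to 0. *)
Lemma ae_cvg0_of_integral_le {d} {T : measurableType d} {R : realType}
    (mu : {measure set T -> \bar R}) (f : nat -> T -> R) (C : R) :
  (forall n, measurable_fun setT (f n)) -> (forall n w, 0 <= f n w) ->
  (forall n, (\int[mu]_w (f n w)%:E <= (C / n.+1%:R ^+ 2)%:E)%E) ->
  {ae mu, forall w, f n w @[n --> \oo] --> 0}.
Proof.
move=> mf f0 fC.
have C0 : 0 <= C.
  have := fC 0%N; rewrite expr1n divr1 => h; rewrite -lee_fin (le_trans _ h)//.
  by apply: integral_ge0 => w _; rewrite lee_fin.
have mEf n : measurable_fun setT (fun w => (f n w)%:E) by exact/measurable_EFinP.
have F0 w : (0 <= \sum_(n <oo) (f n w)%:E)%E.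
  by apply: nneseries_ge0 => n _ _; rewrite lee_fin.
have iF : mu.-integrable setT (fun w => \sum_(n <oo) (f n w)%:E)%E.
  apply/integrableP; split.
    by apply: ge0_emeasurable_sum => // n w _ _; rewrite lee_fin.
  under eq_integral do rewrite gee0_abs//.
  rewrite integral_nneseries//; last by move=> n w _; rewrite lee_fin.
  apply: (@le_lt_trans _ _ (C * 2)%:E); last by rewrite ltry.
  apply: lime_le.
    by apply: is_cvg_nneseries => n _ _; apply: integral_ge0 => w _; rewrite lee_fin.
  apply: nearW => n; apply: (@le_trans _ _ (\sum_(0 <= i < n) (C / i.+1%:R ^+ 2)%:E)%E).
    by apply: lee_sum => i _; exact: fC.
  rewrite sumEFin lee_fin -mulr_sumr ler_wpM2l//.
  exact: sum_invr_sqr_le.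
have := integrable_ae measurableT iF.
apply: filterS => w /(_ I) fin; apply: cvg0_of_nneseries_fin => //.
by rewrite -ge0_fin_numE.
Qed.

(** * Limits of real sequences *)

Lemma cvg_prod_seq {R : realType} {I : eqType} (r : seq I)
    (f : I -> nat -> R) (l : I -> R) :
  (forall i, i \in r -> f i n @[n --> \oo] --> l i) ->
  \prod_(i <- r) f i n @[n --> \oo] --> \prod_(i <- r) l i.
Proof.
move=> fl; rewrite big_seq; under eq_fun do rewrite big_seq.
by apply: cvg_big => //; exact: mul_continuous.
Qed.

Lemma cvg_sum_seq {R : realType} {I : eqType} (r : seq I) (Q : pred I)
    (f : I -> nat -> R) (l : I -> R) :
  (forall i, i \in r -> Q i -> f i n @[n --> \oo] --> l i) ->
  \sum_(i <- r | Q i) f i n @[n --> \oo] --> \sum_(i <- r | Q i) l i.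
Proof.
move=> fl; rewrite big_seq_cond; under eq_fun do rewrite big_seq_cond.
apply: cvg_big => [|i /andP[]]; first exact: add_continuous.
exact: fl.
Qed.

(** Up to an index N the terms of u contribute a constant, which the divergent
    denominator absorbs; beyond N each u i is at most (e / 2) * w i. *)
Lemma weighted_cesaro0 {R : realType} (u w : nat -> R) :
  (forall n, 0 < w n) -> u n / w n @[n --> \oo] --> 0 ->
  \sum_(i < n) w i @[n --> \oo] --> +oo ->
  (\sum_(i < n) u i) / (\sum_(i < n) w i) @[n --> \oo] --> 0.
Proof.
move=> w0 uw wy.
apply/cvgr0Pnorm_le => e e0.
have e20 : 0 < e / 2 by rewrite divr_gt0.
have [N _ HN] := (cvgr0Pnorm_le _).1 uw _ e20.
pose C := \sum_(i < N) `|u i|.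
near=> n.
have W0 : 0 < \sum_(i < n) w i.
  near: n; move/cvgryPgt : wy => /(_ 0); exact.
have WC : C / (e / 2) <= \sum_(i < n) w i.
  by near: n; move/cvgryPge : wy; exact.
have Nn : (N <= n)%N by near: n; exact: nbhs_infty_ge.
rewrite normrM normfV (gtr0_norm W0) ler_pdivrMr//.
rewrite (le_trans (ler_norm_sum _ _ _))//.
rewrite -(big_mkord xpredT (fun i => `|u i|)) (big_cat_nat (leq0n N) Nn)/=.
rewrite big_mkord [e]splitr mulrDl; apply: lerD.
  by rewrite mulrC -ler_pdivrMr.
apply: (@le_trans _ _ (\sum_(N <= i < n) (e / 2 * w i))).
  apply: ler_sum_nat => i /andP[Ni _].
  have := HN i Ni; rewrite normrM normfV (gtr0_norm (w0 i)).
  by rewrite ler_pdivrMr.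
rewrite -mulr_sumr ler_pM2l// -[leRHS](big_mkord xpredT) (big_cat_nat (leq0n N) Nn)/=.
by rewrite lerDr sumr_ge0// => i _; exact: ltW.
Unshelve. all: by end_near. Qed.

(** The Stolz-Cesaro theorem, with the denominators given by their increments
    w. Subtracting l * w from u reduces it to the limit 0. *)
Lemma weighted_cesaro {R : realType} (u w : nat -> R) (l : R) :
  (forall n, 0 < w n) -> u n / w n @[n --> \oo] --> l ->
  \sum_(i < n) w i @[n --> \oo] --> +oo ->
  (\sum_(i < n) u i) / (\sum_(i < n) w i) @[n --> \oo] --> l.
Proof.
move=> w0 uw wy.
have H : (\sum_(i < n) (u i - l * w i)) / (\sum_(i < n) w i) @[n --> \oo] --> 0.
  apply: (@weighted_cesaro0 R (fun n => u n - l * w n) w w0 _ wy).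
  have -> : (fun n => (u n - l * w n) / w n) = (fun n => u n / w n - l).
    by apply/funext => n; rewrite mulrBl mulfK// gt_eqF.
  by rewrite -(subrr l); exact: (cvgB uw (cvg_cst l)).
rewrite -[l]add0r.
apply: cvg_trans (cvgD H (cvg_cst l)).
apply: near_eq_cvg; near=> n => /=.
have W0 : 0 < \sum_(i < n) w i.
  near: n; move/cvgryPgt : wy => /(_ 0); exact.
rewrite [LHS](_ : _ = (\sum_(i < n) (u i - l * w i)) / (\sum_(i < n) w i) + l)//.
by rewrite sumrB -mulr_sumr mulrBl mulfK ?gt_eqF// subrK.
Unshelve. all: by end_near. Qed.

(** The quotient equals the difference quotient of x `^ (s + 1) at x = 1 for the
    increment - 1 / (n + 1), whose limit is the derivative s + 1. *)
Lemma powR_diff_cvg {R : realType} (s : R) :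
  (n.+1%:R `^ (s + 1) - n%:R `^ (s + 1)) / n.+1%:R `^ s @[n --> \oo] --> s + 1.
Proof.
have [dr der] := is_derive1_powR (s + 1) (@ltr01 R).
have := dr; rewrite /derivable => /cvg_ex[l H].
have le : l = s + 1.
  by rewrite powR1 mulr1 in der; rewrite -der -(cvg_lim _ H).
rewrite {}le in H.
have := (cvgr_dnbhsP _ _ _).1 H (fun n => - n.+1%:R^-1).
move=> {}H; have {}H := H _.
have hn : (forall n, - n.+1%:R^-1 != 0 :> R) /\ - n.+1%:R^-1 @[n --> \oo] --> (0 : R).
  split; first by move=> n; rewrite oppr_eq0 invr_eq0 pnatr_eq0.
  by rewrite -oppr0; apply: cvgN; exact: cvg_harmonic.
move: (H hn).
apply: cvg_trans; apply: near_eq_cvg; near=> n => /=.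
have n0 : 0 < n.+1%:R :> R by rewrite ltr0n.
have -> : - n.+1%:R^-1 *: 1 + 1 = n%:R / n.+1%:R :> R.
  rewrite /GRing.scale/= mulr1 -[in RHS](addrK 1 n%:R) natr1 mulrBl mulfV ?gt_eqF//.
  by rewrite mul1r addrC.
have xV : n.+1%:R^-1 `^ (s + 1) = (n.+1%:R `^ s * n.+1%:R)^-1 :> R.
  rewrite -powR_inv1 ?(ltW n0)// -powRrM mulN1r powRN powRD; last first.
    by rewrite (gt_eqF n0) implybT.
  by rewrite powRr1 ?(ltW n0).
have xp : n.+1%:R `^ (s + 1) = n.+1%:R `^ s * n.+1%:R :> R.
  rewrite powRD; last by rewrite (gt_eqF n0) implybT.
  by rewrite powRr1 ?(ltW n0).
rewrite powR1 powRM ?invr_ge0// ?(ltW n0)// xV xp /GRing.scale/=.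
have ns0 : n.+1%:R `^ s != 0 :> R by rewrite gt_eqF// powR_gt0.
set x := n.+1%:R in n0 ns0 *; set B := x `^ s in ns0 *.
field.
by rewrite ns0 nat1r pnatr_eq0.
Unshelve. all: by end_near. Qed.

(** The increments of n `^ (a + 1) are equivalent to (a + 1) * n `^ a, so this
    is weighted_cesaro with these increments as weights. *)
Lemma powR_cesaro {R : realType} (a L : R) (u : nat -> R) : 0 <= a ->
  u n / n.+1%:R `^ a @[n --> \oo] --> L ->
  (\sum_(i < n) u i) / n%:R `^ (a + 1) @[n --> \oo] --> L / (a + 1).
Proof.
move=> a0 uL.
have a10 : 0 < a + 1 by rewrite ltr_wpDl.
pose w n : R := n.+1%:R `^ (a + 1) - n%:R `^ (a + 1).
have w0 n : 0 < w n.
  by rewrite subr_gt0 gt0_ltr_powR// ?nnegrE ?ler0n// ltr_nat.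
have sumw n : \sum_(i < n) w i = n%:R `^ (a + 1).
  rewrite -(big_mkord xpredT w) telescope_sumr// powR0 ?subr0//.
  by rewrite gt_eqF.
have -> : (fun n => (\sum_(i < n) u i) / n%:R `^ (a + 1)) =
          (fun n => (\sum_(i < n) u i) / \sum_(i < n) w i).
  by apply/funext => n; rewrite sumw.
apply: weighted_cesaro => //.
  have <- : (fun n => u n / n.+1%:R `^ a * (w n / n.+1%:R `^ a)^-1) =
            (fun n => u n / w n).
    apply/funext => n.
    have na : n.+1%:R `^ a != 0 :> R by rewrite gt_eqF// powR_gt0// ltr0n.
    by rewrite invfM invrK mulrA mulrAC divfK.
  exact: (cvgM uL (cvgV (lt0r_neq0 a10) (@powR_diff_cvg R a))).
apply/cvgryPge => A; near=> n.
rewrite sumw (@le_trans _ _ n%:R)//.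
  near: n.
  exact: nbhs_infty_ger.
have n1 : 1 <= n%:R :> R by rewrite ler1n; near: n; exact: nbhs_infty_gt.
by rewrite le1r_powR// lerDr.
Unshelve. all: by end_near. Qed.

Lemma cvg_powR_shift_ratio {R : realType} (alpha : R) (q : int) :
  (`|(n.+1%:Z + q)%R|%N)%:R `^ alpha / n.+1%:R `^ alpha @[n --> \oo] --> (1 : R).
Proof.
have cont : {for (1 : R), continuous (fun x : R => x `^ alpha)}.
  apply: differentiable_continuous; apply/derivable1_diffP.
  by apply: derivable_powR; rewrite in_itv/= ltr01.
have lim1 : 1 + q%:~R * (n.+1%:R)^-1 @[n --> \oo] --> (1 : R).
  rewrite -[X in _ --> X]addr0 -[X in _ --> _ + X](mulr0 q%:~R).
  apply: cvgD; first exact: cvg_cst.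
  apply: cvgM; first exact: cvg_cst.
  exact: cvg_harmonic.
have := cvg_comp _ _ lim1 cont; rewrite powR1.
apply: cvg_trans; apply: near_eq_cvg; near=> n => /=.
have nq : 0 <= n.+1%:Z + q.
  by have : (`|q| <= n)%N; [near: n; exact: nbhs_infty_ge|lia].
have n0 : 0 < n.+1%:R :> R by rewrite ltr0n.
have xV : (n.+1%:R `^ alpha)^-1 = n.+1%:R^-1 `^ alpha :> R.
  by rewrite -[in RHS]powR_inv1 ?(ltW n0)// -powRrM mulN1r powRN.
rewrite xV -powRM ?ler0n ?invr_ge0 ?(ltW n0)//; congr (_ `^ _).
rewrite natr_absz ger0_norm// intrD mulrDl.
by rewrite -pmulrn mulfV ?gt_eqF.
Unshelve. all: by end_near. Qed.

(** * A strong law for finitely dependent sequences of polynomial growth *)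

(** Cauchy-Schwarz against the constant 1, from 2 * x i * x j <= x i ^+ 2 + x j ^+ 2. *)
Lemma sqr_sum_le {R : realFieldType} (m n : nat) (x : nat -> R) :
  (\sum_(m <= i < n) x i) ^+ 2 <= (n - m)%:R * \sum_(m <= i < n) x i ^+ 2.
Proof.
rewrite expr2 big_distrlr/=.
apply: (@le_trans _ _ (\sum_(m <= i < n) \sum_(m <= j < n) (x i ^+ 2 + x j ^+ 2) / 2)).
  apply: ler_sum => i _; apply: ler_sum => j _.
  by have := sqr_ge0 (x i - x j); rewrite sqrrB; lra.
have -> : \sum_(m <= i < n) \sum_(m <= j < n) (x i ^+ 2 + x j ^+ 2) / 2 =
    \sum_(m <= i < n) ((n - m)%:R * x i ^+ 2 + \sum_(m <= j < n) x j ^+ 2) / 2.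
  apply: eq_bigr => i _; rewrite -mulr_suml big_split/= sumr_const_nat.
  by rewrite mulr_natl.
rewrite -mulr_suml big_split/= sumr_const_nat -mulr_sumr.
set Q := \sum_(_ <= _ < _) _; rewrite -(mulr_natl Q); lra.
Qed.

Lemma count_window_le (i K n : nat) :
  (\sum_(j < n) ((i <= j + K) && (j <= i + K)) <= K.*2.+1)%N.
Proof.
rewrite -(big_mkord xpredT (fun j => nat_of_bool ((i <= j + K) && (j <= i + K))%N)).
have -> s : (\sum_(j <- s) ((i <= j + K) && (j <= i + K)) =
    size [seq j <- s | (i <= j + K) && (j <= i + K)])%N.
  by rewrite size_filter -sum1_count [RHS]big_mkcond.
rewrite -[X in (_ <= X)%N](size_iota (i - K)).
apply: uniq_leq_size; first by rewrite filter_uniq// iota_uniq.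
by move=> j; rewrite mem_filter mem_iota; lia.
Qed.

Lemma between_squares (n : nat) : (0 < n)%N ->
  exists l, (l.+1 ^ 2 <= n < l.+2 ^ 2)%N.
Proof.
elim: n => // -[_ _|n IH _]; first by exists 0%N.
have [//|l /andP[l1 l2]] := IH.
have [h|h] := ltnP n.+2 (l.+2 ^ 2).
  by exists l; rewrite h andbT (leq_trans l1).
exists l.+1; rewrite h/=; nia.
Qed.

Section law_of_large_numbers.
Context {d} {T : measurableType d} {R : realType} (P : probability T R).

(** Let S n be the sum of the first n terms. Only the pairs at distance at most
    K contribute to the second moment of S n, so the normalized second moment
    is O(1/n). This is not summable in n, but it is along the squares
    N l = (l + 1) ^ 2. Between two consecutive squares there are O(l) terms, and
    Cauchy-Schwarz bounds the increment of S by the sum of their squares, whose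
    normalized expectation is O(1/l^2) as well. The variable q l below
    collects both contributions and dominates (S n / n `^ (a + 1)) ^+ 2 for
    N l <= n < N l.+1; it tends to 0 by ae_cvg0_of_integral_le. *)
Lemma centered_strong_law (Z : nat -> T -> R) (a C : R) (K : nat) :
  0 <= a ->
  (forall i, measurable_fun setT (Z i)) ->
  (forall i j, P.-integrable setT (fun w => (Z i w * Z j w)%:E)) ->
  (forall i, \int[P]_w (Z i w * Z i w) <= C * (i.+1%:R `^ a) ^+ 2) ->
  (forall i j, (i + K < j)%N -> \int[P]_w (Z i w * Z j w) = 0) ->
  {ae P, forall w, (\sum_(i < n) Z i w) / n%:R `^ (a + 1) @[n --> \oo] --> 0}.
Proof.
move=> a0 mZ iZZ Z2 Z0.
have C0 : 0 <= C.
  have := Z2 0%N; rewrite powR1 expr1n mulr1; apply: le_trans.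
  by apply: Rintegral_ge0 => w _; rewrite -expr2 sqr_ge0.
have powC (n : nat) : n.+1%:R `^ (a + 1) = n.+1%:R `^ a * n.+1%:R :> R.
  by rewrite powRD ?powRr1// pnatr_eq0 implybT.
pose S n w := \sum_(0 <= i < n) Z i w.
have mS n : measurable_fun setT (S n) by apply: measurable_sum.
have iZ2 i : P.-integrable setT (fun w => (Z i w ^+ 2)%:E) by exact: iZZ.
have iS2 n : P.-integrable setT (fun w => (S n w ^+ 2)%:E).
  rewrite (_ : (fun w => _) = (fun w => (\sum_(i < n) \sum_(j < n) Z i w * Z j w)%:E)).
    by apply: integrable_bigsum => i _; apply: integrable_bigsum => j _; exact: iZZ.
  by apply/funext => w; rewrite /S big_mkord expr2 big_distrlr.
pose N l := (l.+1 ^ 2)%N.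
have NS l : (N l = (N l).-1.+1)%N by rewrite prednK// expn_gt0.
have NE l : (N l)%:R = l.+1%:R ^+ 2 :> R by rewrite /N natrX.
pose den l : R := ((N l)%:R `^ (a + 1)) ^+ 2.
have den_gt0 l : 0 < den l by rewrite exprn_gt0// powR_gt0// NS ltr0n.
have denE l : den l = ((N l)%:R `^ a) ^+ 2 * (l.+1%:R ^+ 2) ^+ 2.
  by rewrite /den NS powC -NS NE exprMn.
have S2_le n : \int[P]_w (S n.+1 w ^+ 2) <=
    n.+1%:R * (K.*2.+1%:R * (C * (n.+1%:R `^ a) ^+ 2)).
  set V := C * _.
  have EZ_le i : (i < n.+1)%N -> \int[P]_w (Z i w ^+ 2) <= V.
    move=> ilen; under eq_Rintegral do rewrite expr2.
    rewrite (le_trans (Z2 i))// ler_wpM2l// ler_pXn2r// ?nnegrE ?powR_ge0//.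
    by rewrite ge0_ler_powR// ?nnegrE ?ler0n// ler_nat.
  (* Distant pairs vanish; a near pair is bounded by the mean of two squares. *)
  have EZZ_le (i j : 'I_n.+1) : \int[P]_w (Z i w * Z j w) <=
      (((i <= j + K) && (j <= i + K))%N : nat)%:R * V.
    have [iK|jK] := ltnP (i + K) j.
      by rewrite Z0// andbF mul0r.
    have [jKi|iK] := ltnP (j + K) i.
      by under eq_Rintegral do rewrite mulrC; rewrite Z0// mul0r.
    rewrite mul1r; apply: (@le_trans _ _ (\int[P]_w (2^-1 * (Z i w ^+ 2 + Z j w ^+ 2)))).
      apply: le_Rintegral => //.
      - exact: iZZ.
      - by apply: integrable_scale; apply: integrable_add.
      move=> w _; have := sqr_ge0 (Z i w - Z j w); rewrite sqrrB; lra.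
    rewrite RintegralZl//; last first.
      exact: integrable_add.
    rewrite RintegralD//; [|exact: iZ2|exact: iZ2].
    have := EZ_le i (ltn_ord i); have := EZ_le j (ltn_ord j); lra.
  have -> : \int[P]_w (S n.+1 w ^+ 2) =
      \int[P]_w (\sum_(i < n.+1) \sum_(j < n.+1) Z i w * Z j w).
    by apply: eq_Rintegral => w _; rewrite /S big_mkord expr2 big_distrlr.
  rewrite Rintegral_sum; last by move=> i _; exact: integrable_bigsum.
  have -> : n.+1%:R * (K.*2.+1%:R * V) = \sum_(i < n.+1) (K.*2.+1%:R * V).
    by rewrite sumr_const card_ord mulr_natl.
  apply: ler_sum => i _; rewrite Rintegral_sum//.
  apply: (le_trans (ler_sum _ (fun j _ => EZZ_le i j))).
  rewrite -mulr_suml -natr_sum ler_wpM2r ?mulr_ge0 ?sqr_ge0// ler_nat.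
  exact: count_window_le.
have gap_le l : \int[P]_w (\sum_(N l <= i < N l.+1) Z i w ^+ 2) <=
    (N l.+1 - N l)%:R * (C * ((N l.+1)%:R `^ a) ^+ 2).
  rewrite Rintegral_sum; last by move=> i _; exact: iZ2.
  rewrite mulr_natl -sumr_const_nat; apply: ler_sum_nat => i /andP[_ iN].
  under eq_Rintegral do rewrite expr2.
  rewrite (le_trans (Z2 i))// ler_wpM2l// ler_pXn2r// ?nnegrE ?powR_ge0//.
  by rewrite ge0_ler_powR// ?nnegrE ?ler0n// ler_nat.
pose q l w := (2 * S (N l) w ^+ 2
  + 2 * ((N l.+1 - N l)%:R * \sum_(N l <= i < N l.+1) Z i w ^+ 2)) / den l.
have mq l : measurable_fun setT (q l).
  apply: measurable_funM => //; apply: measurable_funD.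
    by apply: measurable_funM => //; apply: measurable_funX; exact: mS.
  apply: measurable_funM => //; apply: measurable_funM => //.
  by apply: measurable_sum => i; apply: measurable_funX.
have iq l : P.-integrable setT (fun w => (q l w)%:E).
  rewrite /q; under eq_fun do rewrite mulrC.
  apply: integrable_scale; apply: integrable_add; apply: integrable_scale => //.
  apply: integrable_scale.
  by apply: integrable_bigsum => i _; exact: iZ2.
have q_ge0 l w : 0 <= q l w.
  rewrite /q divr_ge0 ?(ltW (den_gt0 l))// addr_ge0//.
    by rewrite mulr_ge0// sqr_ge0.
  rewrite mulr_ge0// mulr_ge0//; apply: sumr_ge0 => i _; exact: sqr_ge0.
(* The constants come from N l.+1 - N l = 2 * l + 3 <= 3 * (l + 1) and from
   N l.+1 <= 4 * N l. *)
have Eq l : (\int[P]_w (q l w)%:E <=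
    ((2 * K.*2.+1%:R * C + 18 * C * (4 `^ a) ^+ 2) / l.+1%:R ^+ 2)%:E)%E.
  rewrite -[leLHS]fineK ?lee_fin; last exact: integrable_fin_num (iq l).
  rewrite -/(Rintegral P setT (q l)).
  have iG : P.-integrable setT
      (fun w => (\sum_(N l <= i < N l.+1) Z i w ^+ 2)%:E).
    by apply: integrable_bigsum => i _; exact: iZ2.
  have i1 : P.-integrable setT (fun w => (2 * S (N l) w ^+ 2)%:E).
    exact: integrable_scale.
  have i2' : P.-integrable setT
      (fun w => ((N l.+1 - N l)%:R * \sum_(N l <= i < N l.+1) Z i w ^+ 2)%:E).
    exact: integrable_scale.
  have i2 : P.-integrable setT
      (fun w => (2 * ((N l.+1 - N l)%:R * \sum_(N l <= i < N l.+1) Z i w ^+ 2))%:E).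
    exact: integrable_scale.
  rewrite /q RintegralZr//; last exact: integrable_add.
  rewrite RintegralD//.
  rewrite (RintegralZl 2 measurableT (iS2 (N l))) (RintegralZl 2 measurableT i2').
  rewrite (RintegralZl _ measurableT iG).
  have := S2_le (N l).-1; rewrite -NS; set ES := Rintegral _ _ _ => hS.
  have := gap_le l; set EG := Rintegral _ _ _ => hG.
  have lp : 0 < l.+1%:R :> R by rewrite ltr0n.
  have gapE : (N l.+1 - N l)%:R <= 3 * l.+1%:R :> R.
    by rewrite -natrM ler_nat /N; nia.
  set A := (N l)%:R `^ a in hS *.
  have A0 : 0 < A by rewrite powR_gt0// NS ltr0n.
  have BA : (N l.+1)%:R `^ a <= 4 `^ a * A.
    rewrite -powRM// ge0_ler_powR// ?nnegrE ?ler0n ?mulr_ge0//.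
    by rewrite -natrM ler_nat /N; nia.
  have B2A : ((N l.+1)%:R `^ a) ^+ 2 <= (4 `^ a) ^+ 2 * A ^+ 2.
    by rewrite -exprMn ler_pXn2r// nnegrE ?powR_ge0// mulr_ge0// ?powR_ge0// ltW.
  have hG' : (N l.+1 - N l)%:R * EG <=
      9 * l.+1%:R ^+ 2 * (C * ((4 `^ a) ^+ 2 * A ^+ 2)).
    apply: (@le_trans _ _ ((N l.+1 - N l)%:R *
      ((N l.+1 - N l)%:R * (C * (N l.+1)%:R `^ a ^+ 2)))).
      by rewrite ler_wpM2l.
    rewrite mulrA; apply: ler_pM => //.
    - by rewrite mulr_ge0// sqr_ge0.
    - have -> : 9 * l.+1%:R ^+ 2 = 3 * l.+1%:R * (3 * l.+1%:R) :> R by ring.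
      by apply: ler_pM.
    - by rewrite ler_wpM2l.
  rewrite ler_pdivrMr// denE -/A.
  apply: (le_trans (lerD (ler_wpM2l _ hS) (ler_wpM2l _ hG')))=> //.
  rewrite NE le_eqVlt; apply/orP; left; apply/eqP.
  by field; rewrite gt_eqF.
have := ae_cvg0_of_integral_le mq q_ge0 Eq.
apply: filterS => w qw.
apply/cvgr0Pnorm_le => e e0.
have e20 : 0 < e ^+ 2 by rewrite exprn_gt0.
have [l0 _ Hl0] := (cvgr0Pnorm_le _).1 qw _ e20.
exists (N l0) => // n /= ln.
have n0 : (0 < n)%N by rewrite (leq_trans _ ln)// expn_gt0.
have [l /andP[l1 l2]] := between_squares n0.
have l0l : (l0 <= l)%N.
  by rewrite -ltnS -ltnS -(ltn_sqr l0.+1) (leq_ltn_trans ln).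
have nden : den l <= (n%:R `^ (a + 1)) ^+ 2.
  rewrite /den ler_pXn2r// ?nnegrE ?powR_ge0// ge0_ler_powR// ?nnegrE ?ler0n//.
    by rewrite addr_ge0.
  by rewrite ler_nat.
have np : 0 < n%:R `^ (a + 1) :> R by rewrite powR_gt0// ltr0n.
rewrite -(ler_pXn2r (n := 2))// ?nnegrE ?(ltW e0)//.
rewrite normrM normfV (gtr0_norm np) expr_div_n real_normK ?num_real//.
rewrite ler_pdivrMr ?exprn_gt0//.
have := Hl0 l l0l; rewrite ger0_norm// ler_pdivrMr// => h.
rewrite (le_trans _ (le_trans h _))//; last by rewrite ler_pM2l.
rewrite -(big_mkord xpredT (fun i => Z i w)) (big_cat_nat (leq0n (N l)) l1)/=.
rewrite -/(S _ _); set x := S _ _; set y := \sum_(_ <= _ < n) _.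
have xy : (x + y) ^+ 2 <= 2 * x ^+ 2 + 2 * y ^+ 2.
  by have := sqr_ge0 (x - y); rewrite sqrrB sqrrD; lra.
rewrite (le_trans xy)// lerD2l ler_pM2l// (le_trans (sqr_sum_le _ _ _))//.
apply: ler_pM => //; first by rewrite sumr_ge0// => i _; exact: sqr_ge0.
  by rewrite ler_nat leq_sub2r// ltnW.
rewrite [leRHS](big_cat_nat l1 (ltnW l2))/= lerDl sumr_ge0// => i _.
exact: sqr_ge0.
Qed.

End law_of_large_numbers.

(** The means are handled by powR_cesaro, and the centered variables satisfy
    the hypotheses of centered_strong_law, since centering does not increase
    second moments and turns decorrelation into orthogonality. *)
Lemma strong_law_polynomial_growth {d} {T : measurableType d} {R : realType}
    (P : probability T R) (Y : nat -> T -> R) (a C L : R) (K : nat) :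
  0 <= a ->
  (forall i, P.-integrable setT (fun w => (Y i w)%:E)) ->
  (forall i j, P.-integrable setT (fun w => (Y i w * Y j w)%:E)) ->
  (forall i, \int[P]_w (Y i w * Y i w) <= C * (i.+1%:R `^ a) ^+ 2) ->
  (forall i j, (i + K < j)%N ->
     \int[P]_w (Y i w * Y j w) = \int[P]_w Y i w * \int[P]_w Y j w) ->
  (\int[P]_w Y n w) / n.+1%:R `^ a @[n --> \oo] --> L ->
  (\int[P]_w (\sum_(i < n) Y i w)) / n%:R `^ (a + 1) @[n --> \oo] --> L / (a + 1)
  /\ {ae P, forall w, (\sum_(i < n) Y i w) / n%:R `^ (a + 1) @[n --> \oo] --> L / (a + 1)}.
Proof.
move=> a0 iY iYY Y2 Yindep Ylim.
pose c i := \int[P]_w Y i w.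
have ccvg : (\sum_(i < n) c i) / n%:R `^ (a + 1) @[n --> \oo] --> L / (a + 1).
  exact: powR_cesaro.
split.
  rewrite (_ : (fun n => _) = (fun n => (\sum_(i < n) c i) / n%:R `^ (a + 1)))//.
  by apply/funext => n; rewrite Rintegral_sum.
have ic (r : R) : P.-integrable setT (fun _ : T => r%:E).
  exact: finite_measure_integrable_cst.
pose Z i w := Y i w - c i.
have ZZE i j w : Z i w * Z j w =
    Y i w * Y j w + ((- c j) * Y i w + ((- c i) * Y j w + c i * c j)).
  by rewrite /Z; ring.
have iYc i j : P.-integrable setT (fun w => ((- c j) * Y i w)%:E) by exact: integrable_scale.
have iYc2 i j : P.-integrable setT (fun w => ((- c i) * Y j w + c i * c j)%:E).
  exact: integrable_add.
have iYc3 i j : P.-integrable setT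
    (fun w => ((- c j) * Y i w + ((- c i) * Y j w + c i * c j))%:E).
  exact: integrable_add.
have iZZ i j : P.-integrable setT (fun w => (Z i w * Z j w)%:E).
  by under eq_fun do rewrite ZZE; exact: integrable_add.
have EZZ i j : \int[P]_w (Z i w * Z j w) = \int[P]_w (Y i w * Y j w) - c i * c j.
  under eq_Rintegral do rewrite ZZE.
  rewrite (RintegralD measurableT (iYY i j) (iYc3 i j)).
  rewrite (RintegralD measurableT (iYc i j) (iYc2 i j)).
  rewrite (RintegralD measurableT (iYc j i) (ic _)).
  rewrite (RintegralZl _ measurableT (iY i)) (RintegralZl _ measurableT (iY j)).
  rewrite Rintegral_cst// [X in fine X](_ : _ = 1%E); last exact: probability_setT.
  by rewrite /= -/(c i) -/(c j); ring.
have mZ i : measurable_fun setT (Z i).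
  have /integrableP[/measurable_EFinP mY _] := iY i.
  by apply: measurable_funB.
have Z2 i : \int[P]_w (Z i w * Z i w) <= C * (i.+1%:R `^ a) ^+ 2.
  by rewrite EZZ (le_trans _ (Y2 i))// gerBl -expr2 sqr_ge0.
have Z0 i j : (i + K < j)%N -> \int[P]_w (Z i w * Z j w) = 0.
  by move=> ij; rewrite EZZ Yindep// subrr.
have := centered_strong_law a0 mZ iZZ Z2 Z0.
apply: filterS => w Zw.
have <- : (fun n => (\sum_(i < n) Z i w) / n%:R `^ (a + 1)
   + (\sum_(i < n) c i) / n%:R `^ (a + 1)) =
   (fun n => (\sum_(i < n) Y i w) / n%:R `^ (a + 1)).
  apply/funext => n; rewrite -mulrDl -big_split/=; congr (_ / _).
  by apply: eq_bigr => i _; rewrite subrK.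
rewrite -[X in _ --> X]add0r; exact: (cvgD Zw ccvg).
Qed.

(** * Monomials in independent variables *)

(** A product of n numbers is at most the n-th power of the largest, which is
    one of the summands. The induction carries the maximum M; the term 1 covers
    the empty product. *)
Lemma prod_le_sum_exp {R : realDomainType} (I : Type) (s : seq I) (f : I -> R) :
  (forall i, 0 <= f i) ->
  \prod_(i <- s) f i <= 1 + \sum_(i <- s) f i ^+ size s.
Proof.
move=> f0.
suff H (K : nat) (r : seq I) : exists M, [/\ 0 <= M, \prod_(i <- r) f i <= M ^+ size r
    & M ^+ K <= 1 + \sum_(i <- r) f i ^+ K].
  by have [M [_ h1 h2]] := H (size s) s; exact: le_trans h1 h2.
elim: r => [|i r [M [M0 h1 h2]]].
  exists 0; rewrite !big_nil expr0 addr0; split => //.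
  by case: K => [|K]; rewrite ?expr0// exprS mul0r.
have [fM|/ltW Mf] := leP (f i) M.
  exists M; rewrite !big_cons /= exprS; split => //.
    by apply: ler_pM => //; apply: prodr_ge0.
  by rewrite (le_trans h2)// lerD2l lerDr exprn_ge0.
exists (f i); rewrite !big_cons /= exprS; split => //.
  apply: ler_pM => //; first exact: prodr_ge0.
  by rewrite (le_trans h1)// lerXn2r// nnegrE.
rewrite addrCA lerDl addr_ge0// sumr_ge0// => j _; exact: exprn_ge0.
Qed.

(** Even moments, which need no absolute value, control absolute moments. *)
Lemma expr_norm_le {R : realDomainType} (x : R) (k : nat) :
  `|x| ^+ k <= 1 + x ^+ k.*2.
Proof.
rewrite -muln2 exprM -(real_normK (num_real (x ^+ k))) normrX.
set y := _ ^+ k; have := sqr_ge0 (y - 1); have := sqr_ge0 y.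
by rewrite sqrrB expr1n mulr1; lra.
Qed.

Lemma undup_map_in {A B : eqType} (f : A -> B) (s : seq A) :
  {in s &, injective f} -> undup (map f s) = map f (undup s).
Proof.
elim: s => //= x s IH inj.
have inj' : {in s &, injective f}.
  by move=> y z ys zs; apply: inj; rewrite inE ?ys ?zs orbT.
rewrite (_ : (f x \in _) = (x \in s)); first by case: ifP => _; rewrite /= IH.
apply/mapP/idP => [[y ys fxy]|xs]; last by exists x.
by rewrite (inj x y)// inE ?eqxx// ys orbT.
Qed.

Lemma count_mem_map_in {A B : eqType} (f : A -> B) (s : seq A) x :
  {in s &, injective f} -> x \in s -> count_mem (f x) (map f s) = count_mem x s.
Proof.
move=> inj xs; rewrite count_map; apply: eq_in_count => y ys /=.
by apply/eqP/eqP => [|->//]; exact: inj.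
Qed.

Section monomials.
Context {d} {T : measurableType d} {R : realType} (P : probability T R).
Context (I : choiceType) (D : set I) (X : I -> {RV P >-> R}).
Hypothesis indep : independent_RVs D X.
Hypothesis moments : forall i k, D i -> P.-integrable setT (fun w => (X i w ^+ k)%:E).

(** Repetitions in s are powers: walks visit the same entry several times. *)
Definition monomial (s : seq I) (w : T) : R := \prod_(i <- s) X i w.

Lemma monomialE s w :
  monomial s w = \prod_(i <- undup s) X i w ^+ count_mem i s.
Proof. by rewrite /monomial -prodr_undup_exp_count. Qed.

Let fset_of (s : seq I) : {fset I} := [fset i in undup s]%fset.

Let mem_fset_of s i : (i \in fset_of s) = (i \in s).
Proof. by rewrite in_fset/= mem_undup. Qed.

Lemma big_fset_of {V : Type} {idx : V} (op : Monoid.com_law idx) (s : seq I) (F : I -> V) :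
  \big[op/idx]_(i <- fset_of s) F i = \big[op/idx]_(i <- undup s) F i.
Proof.
apply: perm_big; apply: uniq_perm; rewrite ?undup_uniq ?fset_uniq//.
by move=> i; rewrite mem_fset_of mem_undup.
Qed.

Let fset_of_sub s : {in s, forall i, D i} -> [set` fset_of s] `<=` D.
Proof. by move=> sD i /=; rewrite mem_fset_of => /sD. Qed.

Let int_of s i : {in s, forall i, D i} -> i \in fset_of s ->
  P.-integrable setT (fun w => (X i w ^+ count_mem i s)%:E).
Proof. by move=> sD; rewrite mem_fset_of => /sD; exact: moments. Qed.

Lemma integrable_monomial s : {in s, forall i, D i} ->
  P.-integrable setT (fun w => (monomial s w)%:E).
Proof.
move=> sD; under eq_fun do rewrite monomialE -big_fset_of.
apply: (integrable_prod indep (fset_of_sub sD) (phi := fun i x => x ^+ count_mem i s)).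
  by move=> i; exact: measurable_funX.
by move=> i; exact: int_of.
Qed.

(** Equal factors are grouped before independence is applied, which is why the
    product is over undup s with multiplicities as exponents. *)
Lemma expectation_monomial s : {in s, forall i, D i} ->
  \int[P]_w monomial s w = \prod_(i <- undup s) \int[P]_w (X i w ^+ count_mem i s).
Proof.
move=> sD; under eq_Rintegral do rewrite monomialE -big_fset_of.
rewrite (expectation_prod indep (fset_of_sub sD) (phi := fun i x => x ^+ count_mem i s)).
- by rewrite big_fset_of.
- by move=> i; exact: measurable_funX.
- by move=> i; exact: int_of.
Qed.

Lemma monomial_cat s t w : monomial (s ++ t) w = monomial s w * monomial t w.
Proof. exact: big_cat. Qed.

(** Without a common variable, the distinct variables of s ++ t and their
    multiplicities are those of s and of t. *)
Lemma expectation_monomial_cat s t :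
  {in s, forall i, D i} -> {in t, forall i, D i} -> (forall i, i \in s -> i \notin t) ->
  \int[P]_w (monomial s w * monomial t w) =
  \int[P]_w monomial s w * \int[P]_w monomial t w.
Proof.
move=> sD tD st; under eq_Rintegral do rewrite -monomial_cat.
rewrite !expectation_monomial//; last first.
  by move=> i; rewrite mem_cat => /orP[/sD|/tD].
have ts i : i \in t -> i \notin s by apply: contraTN => /st.
rewrite undup_cat big_cat/=; congr (_ * _).
  rewrite (_ : [seq x <- undup s | x \notin t] = undup s); last first.
    by apply/all_filterP/allP => i; rewrite mem_undup => /st.
  rewrite big_seq [RHS]big_seq; apply: eq_bigr => i; rewrite mem_undup => /st it.
  by rewrite count_cat (elimT count_memPn it) addn0.
rewrite big_seq [RHS]big_seq; apply: eq_bigr => i; rewrite mem_undup => /ts it.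
by rewrite count_cat (elimT count_memPn it) add0n.
Qed.

Lemma integrable_norm_pow i k : D i -> P.-integrable setT (fun w => (`|X i w| ^+ k)%:E).
Proof.
move=> Di; under eq_fun do rewrite -normrX; apply: integrable_norm => //.
exact: moments.
Qed.

Lemma expectation_monomial_le (C : R) s : {in s, forall i, D i} ->
  (forall i, i \in s -> \int[P]_w (`|X i w| ^+ size s) <= C) ->
  \int[P]_w monomial s w <= 1 + (size s)%:R * C.
Proof.
move=> sD sC.
have i1 (r : R) : P.-integrable setT (fun _ : T => r%:E).
  exact: finite_measure_integrable_cst.
have iN i : i \in s -> P.-integrable setT (fun w => (`|X i w| ^+ size s)%:E).
  by move=> /sD; exact: integrable_norm_pow.
have iS : P.-integrable setT (fun w => (\sum_(i <- s | i \in s) `|X i w| ^+ size s)%:E).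
  exact: integrable_bigsum.
apply: (@le_trans _ _ (\int[P]_w (1 + \sum_(i <- s | i \in s) `|X i w| ^+ size s))).
  apply: le_Rintegral => //.
  - exact: integrable_monomial.
  - exact: integrable_add.
  move=> w _; rewrite -big_seq (le_trans (ler_norm _))// /monomial normr_prod.
  exact: (@prod_le_sum_exp _ _ s (fun i => `|X i w|)).
rewrite (RintegralD measurableT (i1 1) iS) Rintegral_sum//.
rewrite Rintegral_cst// [X in fine X](_ : _ = 1%E); last exact: probability_setT.
rewrite mul1r lerD2l.
apply: (@le_trans _ _ (\sum_(i <- s | i \in s) C)); first exact: ler_sum.
by rewrite -big_seq big_const_seq count_predT iter_addr_0 mulr_natl.
Qed.

End monomials.

(** * Walks on the integers *)

(** A walk of length k is given by its starting point and its sequence of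
    steps. The flat step 0 stands for a diagonal entry of the matrix. *)
Fixpoint step_seqs (k : nat) : seq (seq int) :=
  if k is k'.+1 then [seq x :: s | x <- [:: -1; 0; 1], s <- step_seqs k'] else [:: [::]].

(** The entry used by a step x from the position p: (true, p) is the diagonal
    entry at p, and (false, q) is the entry joining q and q + 1. *)
Definition edge (p x : int) : bool * int :=
  if x == 0 then (true, p) else (false, Num.min p (p + x)).

Fixpoint edges (p : int) (s : seq int) : seq (bool * int) :=
  if s is x :: s' then edge p x :: edges (p + x) s' else [::].

(** A walk started at p has its largest position at p + height s and its
    smallest at p - depth s; the starting point counts, so both are
    nonnegative. *)
Fixpoint height (s : seq int) : int :=
  if s is x :: s' then Num.max 0 (x + height s') else 0.

Fixpoint depth (s : seq int) : int :=
  if s is x :: s' then Num.max 0 (depth s' - x) else 0.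

Definition displacement (s : seq int) : int := \sum_(x <- s) x.

(** Diagonal entries exist at the positions 1, ..., n; the entry joining q and
    q + 1 exists for 1 <= q < n. *)
Definition in_range (n : nat) (e : bool * int) : bool :=
  (1 <= e.2) && (e.2 + (~~ e.1)%:Z <= n%:Z).

Lemma height_ge0 s : 0 <= height s.
Proof. by case: s => //= x s; rewrite le_max lexx. Qed.

Lemma depth_ge0 s : 0 <= depth s.
Proof. by case: s => //= x s; rewrite le_max lexx. Qed.

Lemma mem_step_seqs k s :
  (s \in step_seqs k) = (size s == k) && all [in [:: -1; 0; 1]] s.
Proof.
elim: k s => [|k IH] [|x s] //.
  by apply/idP => /allpairsP[[y t] /= [_ _]].
apply/idP/idP => [/allpairsP[[y t] /= [hy ht [-> ->]]]|/andP[sk]]; last rewrite [all _ _]/= => /andP[hx hs].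
  by move: ht; rewrite IH => /andP[/eqP-> ->]; rewrite eqxx hy.
by apply: (allpairs_f (fun x s => x :: s)) => //; rewrite IH hs andbT -eqSS.
Qed.

Lemma step_seqs_uniq k : uniq (step_seqs k).
Proof.
elim: k => // k IH; apply: (allpairs_uniq (f := fun x s => x :: s)) => //.
by move=> [x s] [y t] _ _ /= [-> ->].
Qed.

(** An entry exists exactly when both positions that it joins lie between 1
    and n, so only the extreme positions of the walk matter. *)
Lemma all_in_range_edges (n : nat) (p : int) (s : seq int) :
  all [in [:: -1; 0; 1]] s -> 1 <= p -> p <= n%:Z ->
  all (in_range n) (edges p s) = (p + height s <= n%:Z) && (1 <= p - depth s).
Proof.
elim: s p => [|x s IH] p /=; first by move=> _; lia.
move=> /andP[x3 s3] p1 pn.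
have xP : [\/ x = -1, x = 0 | x = 1].
  by move: x3; rewrite !inE => /or3P[]/eqP->; [constructor 1|constructor 2|constructor 3].
have hs := height_ge0 s; have ds := depth_ge0 s.
have -> : in_range n (edge p x) = (1 <= p + x) && (p + x <= n%:Z).
  by case: xP => ->; rewrite /in_range /edge/=; lia.
have [/andP[px1 pxn]|h] := boolP ((1 <= p + x) && (p + x <= n%:Z)).
  by rewrite IH//=; lia.
rewrite /=; lia.
Qed.

Section trace.
Context {R : realType} (d b : nat -> R).

Definition entry (e : bool * int) : R := if e.1 then d `|e.2|%N else b `|e.2|%N.

(** Extended by 0, the matrix acts on all of the integers, and a walk that
    leaves the interval from 1 to n has weight 0. *)
Definition entry_in (n : nat) (e : bool * int) : R :=
  if in_range n e then entry e else 0.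

(** Row i sits at position n - i, because d and b are numbered from the bottom
    right corner. Each entry comes from at most one of the three steps. *)
Lemma tridiagE n (i l : 'I_n) :
  tridiag d b n i l = \sum_(x <- [:: -1; 0; 1])
    ((n - l)%N%:Z == (n - i)%N%:Z + x)%:R * entry_in n (edge (n - i)%N%:Z x).
Proof.
have ni := ltn_ord i; have nl := ltn_ord l.
have em : ((n - l)%N%:Z == (n - i)%N%:Z + -1) = (l == i.+1 :> nat) by lia.
have e0 : ((n - l)%N%:Z == (n - i)%N%:Z + 0) = (i == l) by rewrite -val_eqE /=; lia.
have ep : ((n - l)%N%:Z == (n - i)%N%:Z + 1) = (i == l.+1 :> nat) by lia.
rewrite !big_cons big_nil em e0 ep addr0 mxE /entry_in /entry /in_range /edge/=.
have [<-|il] := eqVneq i l.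
  rewrite (ltn_eqF (ltnSn i)) !mul0r add0r addr0 mul1r.
  by rewrite ifT//; lia.
have [li|li] := eqVneq (l : nat) i.+1.
  rewrite (_ : (i == l.+1 :> nat) = false) ?mul0r ?addr0 ?mul1r; last by lia.
  by rewrite ifT; [congr b|]; lia.
have [li'|li'] := eqVneq (i : nat) l.+1; last by rewrite !mul0r !addr0.
rewrite !mul0r !add0r mul1r.
by rewrite ifT; [congr b|]; lia.
Qed.

Lemma entry_in_edge_eq0 n (p x : int) : x \in [:: -1; 0; 1] ->
  1 <= p <= n%:Z -> ~~ (1 <= p + x <= n%:Z) -> entry_in n (edge p x) = 0.
Proof.
move=> x3 pn pxn; rewrite /entry_in ifN//.
by move: x3; rewrite !inE => /or3P[]/eqP e; move: pxn; rewrite e /in_range /edge/=; lia.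
Qed.

(** Expansion of a matrix power over walks; prepending a step to a walk is a
    multiplication by the matrix on the left. *)
Lemma tridiag_powE n k (i j : 'I_n) :
  (tridiag d b n ^+ k) i j =
  \sum_(s <- step_seqs k | (n - i)%N%:Z + displacement s == (n - j)%N%:Z)
    \prod_(e <- edges (n - i)%N%:Z s) entry_in n e.
Proof.
elim: k i => [|k IH] i.
  rewrite expr0 mxE /= big_cons big_nil /= /displacement !big_nil addr0.
  have ni := ltn_ord i; have nj := ltn_ord j.
  case: eqP => [->|/eqP]; first by rewrite eqxx addr0.
  by rewrite -val_eqE /= => ij; rewrite ifF//; lia.
have ni := ltn_ord i.
rewrite exprS mxE.
under eq_bigr => l _ do rewrite IH tridiagE mulr_suml.
rewrite exchange_big [RHS]big_mkcond.
rewrite (_ : step_seqs k.+1 =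
  [seq x :: s | x <- [:: -1; 0; 1], s <- step_seqs k])// big_allpairs_dep.
apply: eq_big_seq => x x3.
(* A step out of the interval uses an entry 0; otherwise exactly one row sits
   at the end point of the step. *)
have [pn|pn] := boolP (1 <= (n - i)%N%:Z + x <= n%:Z); last first.
  have w0 : entry_in n (edge (n - i)%N%:Z x) = 0.
    by apply: entry_in_edge_eq0 => //; lia.
  rewrite [RHS]big1; last by move=> s _; rewrite /= big_cons w0 mul0r if_same.
  by apply: big1 => l _; rewrite w0 mulr0 mul0r.
pose q := `|((n - i)%N%:Z + x)%R|%N.
have qE : q%:Z = (n - i)%N%:Z + x by rewrite /q; lia.
have ln : (n - q < n)%N by lia.
have xl : (n - Ordinal ln)%N%:Z = (n - i)%N%:Z + x by rewrite /=; lia.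
rewrite (bigD1 (Ordinal ln))//= [X in _ + X]big1 => [|l lx]; last first.
  rewrite (_ : ((n - l)%N%:Z == (n - i)%N%:Z + x) = false) ?mul0r//.
  have nl := ltn_ord l.
  by move: lx; rewrite -val_eqE /=; lia.
rewrite xl eqxx mul1r addr0 mulr_sumr [LHS]big_mkcond; apply: eq_bigr => s _.
by rewrite /displacement !big_cons addrA.
Qed.

(** The total weight of the closed walks whose largest position is j + 1 and
    that stay above 0. The matrix size n does not occur in it. *)
Definition peak_sum (k j : nat) : R :=
  \sum_(s <- step_seqs k | (displacement s == 0) && (height s + depth s <= j%:Z))
    \prod_(e <- edges (j.+1%:Z - height s) s) entry e.

Lemma prod_entry_in n (p : int) (s : seq int) :
  all [in [:: -1; 0; 1]] s -> 1 <= p <= n%:Z ->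
  \prod_(e <- edges p s) entry_in n e =
  if (p + height s <= n%:Z) && (1 <= p - depth s)
  then \prod_(e <- edges p s) entry e else 0.
Proof.
move=> s3 /andP[p1 pn]; rewrite -all_in_range_edges//.
elim: (edges p s) => [|e t IH] /=; first by rewrite !big_nil.
rewrite !big_cons IH /entry_in; case: in_range; last by rewrite mul0r.
by case: all; rewrite ?mulr0.
Qed.

(** The closed walks inside 1, ..., n are sorted by their largest position
    rather than by their starting point. As a consequence the traces for
    varying n are the partial sums of one sequence. *)
Lemma mxtrace_tridiag_pow n k :
  \tr (tridiag d b n ^+ k) = \sum_(j < n) peak_sum k j.
Proof.
rewrite /mxtrace; under eq_bigr do rewrite tridiag_powE.
transitivity (\sum_(i < n) \sum_(s <- step_seqs k | displacement s == 0)
    \prod_(e <- edges i.+1%:Z s) entry_in n e).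
  rewrite (reindex_inj rev_ord_inj)/=; apply: eq_bigr => i _.
  have ni := ltn_ord i.
  rewrite (_ : (n - (n - i.+1))%N = i.+1); last by lia.
  by apply: eq_bigl => s; rewrite -subr_eq0 addrAC subrr add0r.
under [RHS]eq_bigr do rewrite /peak_sum big_mkcondr.
rewrite exchange_big [RHS]exchange_big big_seq_cond [RHS]big_seq_cond.
apply: eq_bigr => s /andP[]; rewrite mem_step_seqs => /andP[_ s3] _.
have h0 := height_ge0 s; have d0 := depth_ge0 s.
(* For fixed steps s, the starting point i + 1 corresponds to the peak i + 1 + h. *)
pose h := `|height s|%N; have hE : height s = h%:Z by rewrite /h gez0_abs.
under eq_bigr => i _.
  rewrite prod_entry_in//; last by have := ltn_ord i; lia.
  over.
pose F (j : nat) := if height s + depth s <= j%:Z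
  then \prod_(e <- edges (j.+1%:Z - height s) s) entry e else 0.
transitivity (\sum_(0 <= i < n - h) F (i + h)%N).
  rewrite -(big_mkord xpredT (fun i : nat =>
    if (i.+1%:Z + height s <= n%:Z) && (1 <= i.+1%:Z - depth s)
    then \prod_(e <- edges i.+1%:Z s) entry e else 0)).
  rewrite (big_cat_nat (leq0n (n - h)) (leq_subr _ _))/=.
  rewrite [X in _ + X]big_nat_cond [X in _ + X]big1 ?addr0; last first.
    by move=> i /andP[/andP[hi _] _]; rewrite ifF//; lia.
  rewrite big_nat_cond [RHS]big_nat_cond; apply: eq_bigr => i /andP[/andP[_ hi] _].
  rewrite /F (_ : _ && _ = (height s + depth s <= (i + h)%N%:Z)); last by lia.
  by rewrite (_ : (i + h).+1%:Z - height s = i.+1%:Z)//; lia.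
have [hn|nh] := leqP h n; last first.
  rewrite big_geq; last by lia.
  by rewrite big1// => j _; rewrite ifF//; have := ltn_ord j; lia.
rewrite -(big_mkord xpredT F) (big_cat_nat (leq0n h) hn)/=.
rewrite [X in _ = X + _]big_nat_cond [X in _ = X + _]big1 ?add0r; last first.
  by move=> j /andP[/andP[_ jh] _]; rewrite /F ifF//; lia.
by rewrite -[in RHS](add0n h) big_addn.
Qed.

End trace.

Lemma edges_shift (p q : int) s :
  edges (p + q) s = [seq (e.1, p + e.2) | e <- edges q s].
Proof.
elim: s q => //= x s IH q; rewrite -addrA IH /edge; congr (_ :: _).
by case: eqP => //= _; congr pair; rewrite -addrA addr_minr.
Qed.

Lemma size_edges p s : size (edges p s) = size s.
Proof. by elim: s p => //= x s IH p; rewrite IH. Qed.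

Lemma height_depth_le_size s : all [in [:: -1; 0; 1]] s ->
  height s <= (size s)%:Z /\ depth s <= (size s)%:Z.
Proof.
elim: s => // x s IH; rewrite [all _ _]/= => /andP[x3 /IH[]] /=.
by move: x3; rewrite !inE => /or3P[]/eqP-> h1 h2; lia.
Qed.

(** * The limit weights and the paths of the limit formula *)

Definition partial_sum (s : seq int) (u : nat) : int := \sum_(x <- take u s) x.

Lemma partial_sum0 s : partial_sum s 0 = 0.
Proof. by rewrite /partial_sum take0 big_nil. Qed.

Lemma partial_sumS s u : partial_sum s u.+1 = partial_sum s u + nth 0 s u.
Proof.
have [us|su] := ltnP u (size s).
  by rewrite /partial_sum (take_nth 0)// big_rcons.
by rewrite /partial_sum !take_oversize ?nth_default ?addr0// ltnW.
Qed.

Lemma partial_sum_size s : partial_sum s (size s) = displacement s.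
Proof. by rewrite /partial_sum take_size. Qed.

Lemma partial_sum_cons x s u : partial_sum (x :: s) u.+1 = x + partial_sum s u.
Proof. by rewrite /partial_sum /= big_cons. Qed.

Lemma partial_sum_le_height s u : partial_sum s u <= height s.
Proof.
elim: s u => [|x s IH] [|u]; rewrite ?partial_sum0 ?height_ge0//.
  by rewrite /partial_sum big_nil.
by rewrite partial_sum_cons /= le_max lerD2l IH orbT.
Qed.

(** Together with partial_sum_le_height: the height is the maximum of the
    partial sums. *)
Lemma height_attained s : exists2 u, (u <= size s)%N & partial_sum s u = height s.
Proof.
elim: s => [|x s [u us uh]]; first by exists 0%N; rewrite ?partial_sum0.
rewrite /= /Num.max; case: ifP => _; last by exists 0%N; rewrite ?partial_sum0.
by exists u.+1; rewrite // partial_sum_cons uh.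
Qed.

Lemma edgesE p s :
  edges p s = [seq edge (p + partial_sum s u) (nth 0 s u) | u <- iota 0 (size s)].
Proof.
elim: s p => //= x s IH p; rewrite partial_sum0 addr0; congr (_ :: _).
rewrite IH (iotaDl 1) -map_comp; apply: eq_map => u /=.
by rewrite add1n partial_sum_cons addrA.
Qed.

(** The walk with steps s, translated so that its maximum is 0. *)
Definition normalized_path (k : nat) (s : seq int) : {ffun 'I_k.+1 -> int} :=
  [ffun u : 'I_k.+1 => partial_sum s u - height s].

Lemma step_src_path k s (u : 'I_k) :
  step_src (normalized_path k s) u = - height s + partial_sum s u.
Proof. by rewrite /step_src ffunE addrC. Qed.

Lemma step_tgt_path k s (u : 'I_k) :
  step_tgt (normalized_path k s) u = - height s + partial_sum s u + nth 0 s u.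
Proof.
rewrite /step_tgt ffunE (_ : nat_of_ord (lift ord0 u) = u.+1)// partial_sumS; ring.
Qed.

Definition closed_walk (s : seq int) : bool := (displacement s == 0) && (0 \notin s).

Lemma nonflat_nth (s : seq int) u : all [in [:: -1; 0; 1]] s -> 0 \notin s -> (u < size s)%N ->
  nth 0 s u = 1 \/ nth 0 s u = -1.
Proof.
move=> s3 s0 us; have us' := mem_nth 0 us.
have := allP s3 _ us'; rewrite /= !inE => /or3P[]/eqP e; [by right| |by left].
by rewrite e in us'; rewrite us' in s0.
Qed.

(** Every nonflat step changes the parity of the position. *)
Lemma odd_displacement (s : seq int) : all [in [:: -1; 0; 1]] s -> 0 \notin s ->
  odd `|displacement s|%N = odd (size s).
Proof.
elim: s => [|x s IH]; first by rewrite /displacement big_nil.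
rewrite [all _ _]/= inE negb_or => /andP[x3 s3] /andP[x0 s0].
rewrite /displacement big_cons -/(displacement s) [size _]/= oddS -IH//.
by move: x3 x0; rewrite !inE => /or3P[]/eqP->//; lia.
Qed.

Lemma normalized_path_inj k : {in [pred s | size s == k] &, injective (normalized_path k)}.
Proof.
move=> s t; rewrite !inE => /eqP sk /eqP tk /ffunP e.
have hst : height s = height t.
  by have := e ord0; rewrite !ffunE /= !partial_sum0 !sub0r => /oppr_inj.
have pst u : (u <= k)%N -> partial_sum s u = partial_sum t u.
  move=> uk; have := e (Ordinal (uk : (u < k.+1)%N)).
  by rewrite !ffunE /= hst => /addIr.
apply: (@eq_from_nth _ 0); first by rewrite sk tk.
move=> u; rewrite sk => uk.
have := pst _ uk; rewrite !partial_sumS pst; last exact: ltnW.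
by move/addrI.
Qed.

(** A path of Gamma k is recovered from its increments, since its maximum is
    fixed to be 0. This enumerates Gamma k by the closed walks without flat
    steps. *)
Lemma GammaE k :
  Gamma k = [set` [seq normalized_path k s | s <- step_seqs k & closed_walk s]].
Proof.
apply/seteqP; split=> [g [g0k g1 gle [u0 gu0]] | g] /=.
  pose G (v : nat) : int := g (inord v).
  pose s := mkseq (fun v => G v.+1 - G v) k.
  have psE u : (u <= k)%N -> partial_sum s u = G u - G 0%N.
    move=> uk; rewrite /partial_sum /s /mkseq -map_take take_iota (minn_idPl uk).
    by rewrite big_map -telescope_sumr// /index_iota subn0.
  have gG (u : 'I_k.+1) : g u = G u by rewrite /G inord_val.
  have sk : size s = k by rewrite size_mkseq.
  (* The maximum of g is 0, and partial sums of s are values of g minus g 0. *)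
  have hs : height s = - G 0%N.
    have [u us hu] := height_attained s; rewrite sk in us.
    have h1 := partial_sum_le_height s u0.
    move: h1 hu; rewrite !psE ?leq_ord// -gG gu0 sub0r => h1 hu.
    have := gle (Ordinal (us : (u < k.+1)%N)); rewrite gG /=; lia.
  have sstep x : x \in s -> x = 1 \/ x = -1.
    move=> /mapP[v]; rewrite mem_iota add0n => /= vk ->.
    have := g1 (Ordinal vk); rewrite /step_src /step_tgt !gG.
    rewrite (_ : nat_of_ord (lift _ _) = v.+1)// (_ : nat_of_ord (widen_ord _ _) = v)//.
    lia.
  apply/mapP; exists s; last first.
    by apply/ffunP => u; rewrite ffunE psE ?leq_ord// hs gG; ring.
  rewrite mem_filter mem_step_seqs sk eqxx /closed_walk -partial_sum_size sk psE//.
  apply/and3P; split.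
  - apply/andP; split.
      rewrite subr_eq0; have := g0k; rewrite !gG /= => ->//.
    by apply/negP => /sstep[].
  - by [].
  - by apply/allP => x /sstep[]->.
move=> /mapP[s]; rewrite mem_filter mem_step_seqs => /andP[/andP[/eqP s0 n0] /andP[/eqP sk s3]] ->.
split.
- by rewrite !ffunE /= partial_sum0 -[X in partial_sum s X]sk partial_sum_size s0.
- move=> u; rewrite step_src_path step_tgt_path.
  have us : (u < size s)%N by rewrite sk.
  by have [->|->] := nonflat_nth s3 n0 us; lia.
- by move=> u; rewrite ffunE subr_le0 partial_sum_le_height.
- have [u us hu] := height_attained s; rewrite sk in us.
  by exists (Ordinal (us : (u < k.+1)%N)); rewrite ffunE /= hu subrr.
Qed.

Lemma crossings_path k s (i : int) : s \in step_seqs k -> 0 \notin s ->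
  crossings (normalized_path k s) i = count_mem (false, i) (edges (- height s) s).
Proof.
rewrite mem_step_seqs => /andP[/eqP sk s3] s0.
rewrite edgesE count_map sk -(val_enum_ord k) count_map.
rewrite /crossings -sum1_card -sum1_count big_enum_cond.
apply: eq_bigl => u /=; rewrite inE step_src_path step_tgt_path /edge.
have us : (u < size s)%N by rewrite sk.
by have [->|->] := nonflat_nth s3 s0 us; rewrite /= xpair_eqE /=; lia.
Qed.

Section limit_weight.
Context {R : realType} (m : nat -> R).

(** The limit, as the peak n of a walk with steps s grows, of its expected
    weight divided by n `^ alpha for each step: a diagonal entry is of smaller
    order and contributes 0, and an off-diagonal entry used c times
    contributes m c. *)
Definition limit_weight (s : seq int) : R :=
  \prod_(e <- undup (edges (- height s) s))
    if e.1 then 0 else m (count_mem e (edges (- height s) s)).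

Lemma edges_bounds (p : int) (s : seq int) e :
  all [in [:: -1; 0; 1]] s -> e \in edges p s ->
  p - depth s <= e.2 <= p + height s.
Proof.
elim: s p => // x s IH p; rewrite [all _ _]/= => /andP[x3 s3].
rewrite [edges _ _]/= inE => /orP[/eqP->|/(IH _ s3)] /=.
  have hs := height_ge0 s; have ds := depth_ge0 s.
  by move: x3; rewrite !inE /edge => /or3P[]/eqP-> /=; lia.
by lia.
Qed.

Lemma limit_weight_flat s : 0 \in s -> limit_weight s = 0.
Proof.
move=> s0; rewrite /limit_weight.
have [q qs] : exists q, (true, q) \in edges (- height s) s.
  elim: s (- height s) s0 => // x s IH p; rewrite inE => /orP[/eqP<-|/(IH (p + x))[q qs]].
    by exists p; rewrite /= /edge eqxx inE eqxx.
  by exists q; rewrite /= inE qs orbT.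
by rewrite (bigD1_seq (true, q)) ?undup_uniq ?mem_undup//= mul0r.
Qed.

(** The edge joining i and i + 1 is used once for each crossing of the line at
    height i + 1/2, and edges that are not used contribute m 0 = 1. *)
Lemma limit_weight_path k s : m 0%N = 1 -> s \in step_seqs k -> 0 \notin s ->
  limit_weight s = \big[*%R/1]_(i \in [set i : int | i < 0]) m (crossings (normalized_path k s) i).
Proof.
move=> m0 sk s0; have := sk; rewrite mem_step_seqs => /andP[/eqP ss s3].
set t := edges (- height s) s.
have tP e : e \in t -> e.1 = false /\ e.2 < 0.
  rewrite /t edgesE => /mapP[u]; rewrite mem_iota add0n => /= us ->.
  have h1 := partial_sum_le_height s u; have h2 := partial_sum_le_height s u.+1.
  rewrite partial_sumS in h2.
  by move: h2; rewrite /edge; have [->|->] := nonflat_nth s3 s0 us => /= h2; split => //; lia.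
pose r := undup [seq e.2 | e <- t].
have -> : \big[*%R/1]_(i \in [set i : int | i < 0]) m (crossings (normalized_path k s) i) =
    \prod_(i <- r) m (crossings (normalized_path k s) i).
  rewrite [RHS]fsbig_seq ?undup_uniq//; apply/esym; apply: fsbig_widen => [i|i [_]] /=.
    by rewrite /r mem_undup => /mapP[e /tP[_ e0] ->].
  rewrite /r mem_undup => /negP ir; rewrite /preimage/= crossings_path// -/t.
  rewrite (elimT count_memPn) ?m0//.
  by apply: contra ir => it; apply/mapP; exists (false, i).
rewrite /limit_weight -/t.
have -> : r = [seq e.2 | e <- undup t].
  apply: undup_map_in => -[x i] [y j] /tP[/= -> _] /tP[/= -> _].
  by move=> ->.
rewrite big_map big_seq [RHS]big_seq; apply: eq_bigr => -[x i].
rewrite mem_undup => /tP[/= -> _].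
by rewrite crossings_path.
Qed.

(** Walks with a flat step have limit weight 0, and for odd k every closed walk
    has a flat step. *)
Lemma limit_momentE (alpha : R) (k : nat) : m 0%N = 1 ->
  limit_moment alpha m k =
  (alpha * k%:R + 1)^-1 * \sum_(s <- step_seqs k | displacement s == 0) limit_weight s.
Proof.
move=> m0.
have -> : \sum_(s <- step_seqs k | displacement s == 0) limit_weight s =
    \sum_(s <- step_seqs k | closed_walk s) limit_weight s.
  rewrite big_mkcond [RHS]big_mkcond; apply: eq_bigr => s _; rewrite /closed_walk.
  case: eqP => //= _; case: (boolP (0 \in s)) => //= s0.
  exact: limit_weight_flat.
rewrite /limit_moment; case: ifPn => kodd.
  rewrite big_seq_cond big1 ?mulr0// => s /andP[]; rewrite mem_step_seqs.
  move=> /andP[/eqP sk s3] /andP[/eqP ds s0].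
  by have := odd_displacement s3 s0; rewrite ds sk kodd.
congr (_ * _); rewrite GammaE -fsbig_seq; last first.
  rewrite map_inj_in_uniq ?filter_uniq ?step_seqs_uniq//.
  move=> s t; rewrite !mem_filter !mem_step_seqs => /and3P[_ sk _] /and3P[_ tk _].
  exact: normalized_path_inj.
rewrite big_map big_filter big_seq_cond [RHS]big_seq_cond.
apply: eq_bigr => s /andP[sk /andP[_ s0]].
by rewrite (limit_weight_path m0 sk).
Qed.

End limit_weight.

(** * The moments of the tridiagonal model *)

Definition var_index (e : bool * int) : bool * nat := (e.1, `|e.2|%N).

Definition peak_monomials (k j : nat) : seq (seq (bool * nat)) :=
  [seq map var_index (edges (j.+1%:Z - height s) s) |
     s <- step_seqs k & (displacement s == 0) && (height s + depth s <= j%:Z)].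

(** The walk has k steps and its maximum is j + 1, so its positions are within
    2 * k of j; this locality gives independence of distant peak sums. *)
Lemma mem_peak_monomials k j r : r \in peak_monomials k j ->
  size r = k /\ forall i, i \in r -> [/\ (0 < i.2)%N, (i.2 <= j.+1)%N & (j < i.2 + k.*2)%N].
Proof.
move=> /mapP[s]; rewrite mem_filter mem_step_seqs => /andP[/andP[_ hd] /andP[/eqP sk s3]] ->.
rewrite size_map size_edges; split => // i /mapP[e /(edges_bounds s3) eb ->] /=.
have [hk dk] := height_depth_le_size s3; rewrite sk in hk dk.
have h0 := height_ge0 s; have d0 := depth_ge0 s.
move: (e.2) (height s) (depth s) eb hd hk dk h0 d0 => q h l eb hd hk dk h0 d0.
by split; lia.
Qed.

Lemma size_peak_monomials k j : (size (peak_monomials k j) <= size (step_seqs k))%N.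
Proof. by rewrite size_map size_filter count_size. Qed.

Section tridiagonal_model.
Context {R : realType} {disp : measure_display} {T : measurableType disp}
  (P : probability T R) (alpha : R) (d b : nat -> {RV P >-> R}) (m : nat -> R).
Hypothesis alpha_gt0 : 0 < alpha.
Hypothesis b_finite : forall n k : nat, (0 < n)%N ->
     P.-integrable setT (fun w => (b n w ^+ k)%:E).
Hypothesis b_lim : forall k : nat,
     (fun n : nat => 'E_P[(fun w => ((b n w / n%:R `^ alpha) ^+ k)%R)]%E)
       @ \oo --> (m k)%:E.
Hypothesis d_bnd : forall k : nat,
     (ereal_sup [set 'E_P[(fun w => (`|d n w| ^+ k)%R)] | n in [set n | (0 < n)%N]]
        < +oo)%E.

Let D : set (bool * nat) := [set i : bool * nat | (0 < i.2)%N].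
Let X (i : bool * nat) : {RV P >-> R} := if i.1 then d i.2 else b i.2.

Lemma d_moments_le k : exists C, 0 <= C /\ forall n, (0 < n)%N ->
  (\int[P]_w (`|d n w| ^+ k)%:E <= C%:E)%E.
Proof.
have := d_bnd k; set S := ereal_sup _ => Sfin.
have dS n : (0 < n)%N -> (\int[P]_w (`|d n w| ^+ k)%:E <= S)%E.
  move=> n0; apply: ereal_sup_ubound; exists n => //.
  by rewrite unlock.
have S0 : (0 <= S)%E.
  by apply: le_trans (dS 1%N isT); apply: integral_ge0 => w _; rewrite lee_fin exprn_ge0.
exists (fine S); split; first exact: fine_ge0.
by move=> n n0; rewrite fineK ?ge0_fin_numE//; exact: dS.
Qed.

Lemma variable_moments i k : D i -> P.-integrable setT (fun w => (X i w ^+ k)%:E).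
Proof.
case: i => -[] n /= n0; last exact: b_finite.
apply/integrableP; split; first exact/measurable_EFinP/measurable_funX.
have [C [_ dC]] := d_moments_le k.
under eq_integral do rewrite abse_EFin normrX.
by rewrite (le_lt_trans (dC n n0))// ltry.
Qed.

Lemma b_scaled_lim k :
  \int[P]_w ((b n w / n%:R `^ alpha) ^+ k) @[n --> \oo] --> m k.
Proof.
have -> : (fun n => \int[P]_w ((b n w / n%:R `^ alpha) ^+ k)) =
    fine \o (fun n => 'E_P[(fun w => ((b n w / n%:R `^ alpha) ^+ k)%R)]%E).
  by apply/funext => n; rewrite /= unlock.
exact: (fine_cvg (@b_lim k)).
Qed.

Let powpos (n : nat) : (0 < n)%N -> 0 < n%:R `^ alpha :> R.
Proof. by move=> n0; rewrite powR_gt0// ltr0n. Qed.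

Lemma b_scaled_integrable n k : (0 < n)%N ->
  P.-integrable setT (fun w => ((b n w / n%:R `^ alpha) ^+ k)%:E).
Proof.
move=> n0; under eq_fun do rewrite expr_div_n mulrC.
by apply: integrable_scale; exact: b_finite.
Qed.

(** Diagonal entries have bounded moments, which is more than required because
    i.2 `^ alpha >= 1. For the others the moments of b n / n `^ alpha converge,
    hence are bounded. *)
Lemma variable_moments_le k : exists C, 0 <= C /\ forall i, D i ->
  \int[P]_w (`|X i w| ^+ k) <= C * (i.2%:R `^ alpha) ^+ k.
Proof.
have [C1 [C10 dC]] := d_moments_le k.
have [M Mb] : exists M, forall n, \int[P]_w ((b n w / n%:R `^ alpha) ^+ k.*2) <= M.
  have /cvg_seq_bounded[M [_ HM]] : cvgn (fun n => \int[P]_w ((b n w / n%:R `^ alpha) ^+ k.*2)).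
    by apply/cvg_ex; exists (m k.*2); exact: (@b_scaled_lim k.*2).
  exists (M + 1) => n; apply: le_trans (ler_norm _) _; apply: HM => //.
  by rewrite ltrDl.
have i1 (r : R) : P.-integrable setT (fun _ : T => r%:E).
  exact: finite_measure_integrable_cst.
have M0 : 0 <= 1 + M.
  rewrite addr_ge0// (le_trans _ (Mb 0%N))//; apply: Rintegral_ge0 => w _.
  by rewrite -muln2 exprM sqr_ge0.
have one_le (n : nat) : (0 < n)%N -> 1 <= (n%:R `^ alpha) ^+ k :> R.
  move=> n0; rewrite exprn_ege1// -[leLHS](powRr0 n%:R) ler_powR ?(ltW alpha_gt0)//.
  by rewrite ler1n.
exists (C1 + (1 + M)); split; first exact: addr_ge0.
case=> -[] n /= n0.
  apply: (@le_trans _ _ C1).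
    by rewrite -lee_fin fineK; [exact: dC|exact: integrable_fin_num (integrable_norm_pow variable_moments _ (i := (true, n)) n0)].
  apply: (@le_trans _ _ (C1 + (1 + M))); first by rewrite lerDl.
  by apply: ler_peMr; [exact: addr_ge0|exact: one_le].
have np := powpos n0.
apply: (@le_trans _ _ (\int[P]_w ((n%:R `^ alpha) ^+ k * (1 + (b n w / n%:R `^ alpha) ^+ k.*2)))).
  apply: le_Rintegral => //.
  - exact: (integrable_norm_pow variable_moments _ (i := (false, n))).
  - apply: integrable_scale; apply: integrable_add => //; exact: b_scaled_integrable.
  move=> w _; rewrite -ler_pdivrMl ?exprn_gt0// mulrC -exprVn -exprMn.
  rewrite -[X in _ / X]gtr0_norm// -normf_div; exact: expr_norm_le.
rewrite (RintegralZl _ measurableT); last first.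
  by apply: integrable_add => //; exact: b_scaled_integrable.
rewrite (RintegralD measurableT (i1 1) (b_scaled_integrable _ n0)).
rewrite Rintegral_cst// [X in fine X](_ : _ = 1%E); last exact: probability_setT.
rewrite mul1r mulrC ler_wpM2r ?exprn_ge0 ?(ltW np)//.
by rewrite (@le_trans _ _ (1 + M))// ?lerD2l// lerDr.
Qed.

Hypothesis indep : independent_RVs D X.

Let Y (k j : nat) (w : T) : R := peak_sum (fun n => d n w) (fun n => b n w) k j.

Lemma peak_sumE k j w : Y k j w = \sum_(r <- peak_monomials k j) monomial X r w.
Proof.
rewrite /Y /peak_sum /peak_monomials big_map big_filter; apply: eq_bigr => s _.
rewrite /monomial big_map; apply: eq_bigr => -[t q] _.
by rewrite /entry /X /=; case: t.
Qed.

Lemma peak_monomials_dom k j r : r \in peak_monomials k j -> {in r, forall i, D i}.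
Proof. by move=> /mem_peak_monomials[_ rP] i /rP[]. Qed.

Lemma integrable_peak_sum k j : P.-integrable setT (fun w => (Y k j w)%:E).
Proof.
under eq_fun do rewrite peak_sumE big_seq.
apply: integrable_bigsum => r rj.
exact: (integrable_monomial indep variable_moments (peak_monomials_dom rj)).
Qed.

Lemma peak_sum_mulE k i j w : Y k i w * Y k j w =
  \sum_(r <- peak_monomials k i | r \in peak_monomials k i)
    \sum_(s <- peak_monomials k j | s \in peak_monomials k j)
      monomial X r w * monomial X s w.
Proof.
rewrite !peak_sumE big_distrlr /= big_seq; apply: eq_bigr => r _.
by rewrite big_seq.
Qed.

Let integrable_mul_monomial r s : {in r, forall i, D i} -> {in s, forall i, D i} ->
  P.-integrable setT (fun w => (monomial X r w * monomial X s w)%:E).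
Proof.
move=> rD sD; under eq_fun do rewrite -monomial_cat.
apply: (integrable_monomial indep variable_moments) => i.
by rewrite mem_cat => /orP[/rD|/sD].
Qed.

Lemma integrable_peak_sum_mul k i j :
  P.-integrable setT (fun w => (Y k i w * Y k j w)%:E).
Proof.
under eq_fun do rewrite peak_sum_mulE.
apply: integrable_bigsum => r ri; apply: integrable_bigsum => s sj.
exact: integrable_mul_monomial (peak_monomials_dom ri) (peak_monomials_dom sj).
Qed.

(** Walks with peaks at distance more than 2 * k use disjoint sets of
    variables. *)
Lemma expectation_peak_sum_mul k i j : (i + k.*2 < j)%N ->
  \int[P]_w (Y k i w * Y k j w) = \int[P]_w Y k i w * \int[P]_w Y k j w.
Proof.
move=> ij.
have im l r : r \in peak_monomials k l ->
    P.-integrable setT (fun w => (monomial X r w)%:E).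
  move=> rl; exact: (integrable_monomial indep variable_moments (peak_monomials_dom rl)).
have EY l : \int[P]_w Y k l w =
    \sum_(r <- peak_monomials k l | r \in peak_monomials k l) \int[P]_w monomial X r w.
  under eq_Rintegral do rewrite peak_sumE big_seq.
  by rewrite Rintegral_sum// => r; exact: im.
under eq_Rintegral do rewrite peak_sum_mulE.
rewrite Rintegral_sum; last first.
  move=> r ri; apply: integrable_bigsum => s sj.
  exact: integrable_mul_monomial (peak_monomials_dom ri) (peak_monomials_dom sj).
rewrite !EY big_distrlr/=; apply: eq_bigr => r ri.
rewrite Rintegral_sum; last first.
  by move=> s sj; exact: integrable_mul_monomial (peak_monomials_dom ri) (peak_monomials_dom sj).
apply: eq_bigr => s sj.
apply: (expectation_monomial_cat indep variable_moments).
- exact: peak_monomials_dom ri.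
- exact: peak_monomials_dom sj.
move=> v vr; apply/negP => vs.
have [_ /(_ v vr)[_ vi _]] := mem_peak_monomials ri.
have [_ /(_ v vs)[_ _ jv]] := mem_peak_monomials sj.
lia.
Qed.

Lemma natr_powR_mul (n k : nat) :
  n%:R `^ (alpha * k%:R) = (n%:R `^ alpha) ^+ k :> R.
Proof. by rewrite powRrM powR_mulrn// powR_ge0. Qed.

(** The number of walks is bounded in j, and each product of two of them is a
    monomial of length 2 * k in variables of order at most (j + 1) `^ alpha. *)
Lemma peak_sum_sqr_le k : exists C, forall j,
  \int[P]_w (Y k j w * Y k j w) <= C * (j.+1%:R `^ (alpha * k%:R)) ^+ 2.
Proof.
have [C [C0 HC]] := variable_moments_le (k + k).
pose N : R := (size (step_seqs k))%:R.
exists (N * (N * (1 + (k + k)%:R * C))) => j.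
under eq_Rintegral do rewrite peak_sum_mulE.
rewrite Rintegral_sum; last first.
  move=> r ri; apply: integrable_bigsum => s sj.
  exact: integrable_mul_monomial (peak_monomials_dom ri) (peak_monomials_dom sj).
pose B : R := (j.+1%:R `^ alpha) ^+ (k + k).
have B1 : 1 <= B.
  rewrite exprn_ege1// -[leLHS](powRr0 j.+1%:R) ler_powR ?(ltW alpha_gt0)//.
  by rewrite ler1n.
have B0 : 0 <= B by exact: le_trans B1.
have -> : (j.+1%:R `^ (alpha * k%:R)) ^+ 2 = B.
  by rewrite natr_powR_mul -exprM muln2 -addnn.
have mono_le r s : r \in peak_monomials k j -> s \in peak_monomials k j ->
    \int[P]_w (monomial X r w * monomial X s w) <= (1 + (k + k)%:R * C) * B.
  move=> rj sj.
  have [rk rP] := mem_peak_monomials rj; have [sk sP] := mem_peak_monomials sj.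
  have rsP i : i \in r ++ s -> D i /\ (i.2 <= j.+1)%N.
    by rewrite mem_cat => /orP[/rP[]|/sP[]].
  have rsk : size (r ++ s) = (k + k)%N by rewrite size_cat rk sk.
  under eq_Rintegral do rewrite -monomial_cat.
  apply: (@le_trans _ _ (1 + (size (r ++ s))%:R * (C * B))).
    apply: (expectation_monomial_le indep variable_moments) => i irs.
      by have [] := rsP i irs.
    have [Di ij] := rsP i irs.
    rewrite rsk (le_trans (HC i Di))// ler_wpM2l// lerXn2r// ?nnegrE ?powR_ge0//.
    by rewrite ge0_ler_powR// ?(ltW alpha_gt0)// ?nnegrE ?ler0n// ler_nat.
  by rewrite rsk mulrDl mul1r mulrA lerD2r.
have V0 : 0 <= (1 + (k + k)%:R * C) * B.
  by rewrite mulr_ge0// addr_ge0// mulr_ge0.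
have sumle (c : R) : 0 <= c -> \sum_(r <- peak_monomials k j | r \in peak_monomials k j) c <= N * c.
  move=> c0; rewrite -big_seq big_const_seq count_predT iter_addr_0 -[leLHS]mulr_natl.
  by rewrite ler_wpM2r// ler_nat size_peak_monomials.
rewrite -!mulrA; apply: (le_trans _ (sumle _ _)); last by rewrite mulr_ge0.
apply: ler_sum => r rj.
rewrite Rintegral_sum; last first.
  by move=> s sj; exact: integrable_mul_monomial (peak_monomials_dom rj) (peak_monomials_dom sj).
apply: (le_trans _ (sumle _ V0)); apply: ler_sum => s sj.
exact: mono_le.
Qed.

Lemma invr_powR_cvg0 : (n.+1%:R `^ alpha)^-1 @[n --> \oo] --> (0 : R).
Proof.
have h : (forall n, 0 < n.+1%:R^-1 :> R) /\ n.+1%:R^-1 @[n --> \oo] --> (0 : R).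
  by split; [move=> n; rewrite invr_gt0 ltr0n|exact: cvg_harmonic].
have := (cvg_at_rightP _ _ _).1 (powR_cvg0 alpha_gt0) _ h.
rewrite (_ : (fun n => n.+1%:R^-1 `^ alpha) = (fun n => (n.+1%:R `^ alpha)^-1))//.
apply/funext => n.
by rewrite -powR_inv1 ?ler0n// -powRrM mulN1r powRN.
Qed.

(** Diagonal moments are bounded while the denominator grows. For the others,
    the relative position e.2 stays fixed as the peak n + 1 grows, so
    normalizing by (n + 1) `^ alpha instead of (n + 1 + e.2) `^ alpha does not
    change the limit. *)
Lemma variable_moment_lim (e : bool * int) (c : nat) : (0 < c)%N ->
  (\int[P]_w (X (var_index (e.1, n.+1%:Z + e.2)) w ^+ c)) / (n.+1%:R `^ alpha) ^+ c
    @[n --> \oo] --> if e.1 then 0 else m c.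
Proof.
case: e => -[] q c0 /=.
  have [C [C0 dC]] := d_moments_le c.
  have lim0 : C * ((n.+1%:R `^ alpha)^-1) ^+ c @[n --> \oo] --> (0 : R).
    rewrite -[X in _ --> X](mulr0 C).
    have l0 : ((n.+1%:R `^ alpha)^-1) ^+ c @[n --> \oo] --> (0 : R) ^+ c.
      exact: (cvg_comp _ _ invr_powR_cvg0 (@exprn_continuous R c 0)).
    by rewrite expr0n gtn_eqF// in l0; exact: (cvgM (cvg_cst C) l0).
  apply/cvgr0Pnorm_le => e e0.
  have nearC := (cvgr0Pnorm_le _).1 lim0 _ e0.
  near=> n.
  have np : 0 < n.+1%:R `^ alpha :> R by exact: powpos.
  have qn : (0 < `|(n.+1%:Z + q)%R|%N)%N.
    by have : (`|q| <= n)%N; [near: n; exact: nbhs_infty_ge|lia].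
  rewrite normrM (gtr0_norm (x := _ ^-1)) ?invr_gt0 ?exprn_gt0//.
  apply: (@le_trans _ _ (C * ((n.+1%:R `^ alpha)^-1) ^+ c)).
    rewrite exprVn ler_wpM2r ?invr_ge0 ?exprn_ge0 ?(ltW np)//.
    have iX := @variable_moments (true, `|(n.+1%:Z + q)%R|%N) c qn.
    rewrite (le_trans (le_normr_Rintegral measurableT iX))//.
    under eq_Rintegral do rewrite normrX.
    rewrite -lee_fin fineK; first exact: dC.
    apply: integrable_fin_num => //.
    exact: (integrable_norm_pow variable_moments c (i := (true, _)) qn).
  apply: le_trans (ler_norm _) _.
  by near: n; exact: nearC.
have idx : `|(n.+1%:Z + q)%R|%N @[n --> \oo] --> \oo.
  apply/cvgnyPge => A; near=> n.
  by have : (`|q| + A <= n)%N; [near: n; exact: nbhs_infty_ge|lia].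
have l1 := cvg_comp _ _ idx (@b_scaled_lim c).
have l2 : ((`|(n.+1%:Z + q)%R|%N)%:R `^ alpha / n.+1%:R `^ alpha) ^+ c @[n --> \oo] --> (1 : R).
  rewrite -[X in _ --> X](expr1n R c).
  exact: (cvg_comp _ _ (cvg_powR_shift_ratio alpha q) (@exprn_continuous R c 1)).
rewrite -[X in _ --> X]mulr1.
apply: cvg_trans (cvgM l1 l2); apply: near_eq_cvg; near=> n.
set n' := `|(n.+1%:Z + q)%R|%N.
have n'0 : (0 < n')%N.
  by rewrite /n'; have : (`|q| <= n)%N; [near: n; exact: nbhs_infty_ge|lia].
have np' := powpos n'0.
rewrite [LHS](_ : _ = \int[P]_w ((b n' w / n'%:R `^ alpha) ^+ c) *
  (n'%:R `^ alpha / n.+1%:R `^ alpha) ^+ c)//.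
under eq_Rintegral do rewrite expr_div_n.
rewrite RintegralZr//; last exact: b_finite.
by rewrite expr_div_n mulrA divfK// gt_eqF// exprn_gt0.
Unshelve. all: by end_near. Qed.

(** For j large every closed walk fits above 0, and its expected weight factors
    over its distinct edges, placed relative to the peak; each factor
    converges by variable_moment_lim. *)
Lemma peak_sum_mean_lim k :
  (\int[P]_w Y k n w) / n.+1%:R `^ (alpha * k%:R) @[n --> \oo] -->
  \sum_(s <- step_seqs k | displacement s == 0) limit_weight m s.
Proof.
pose mono n s := map var_index (edges (n.+1%:Z - height s) s).
pose term s n : R := (if height s + depth s <= n%:Z
  then \int[P]_w monomial X (mono n s) w else 0) / n.+1%:R `^ (alpha * k%:R).
have EY n : (\int[P]_w Y k n w) / n.+1%:R `^ (alpha * k%:R) =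
    \sum_(s <- step_seqs k | displacement s == 0) term s n.
  under eq_Rintegral do rewrite peak_sumE big_seq.
  rewrite Rintegral_sum; last first.
    move=> r rn; exact: (integrable_monomial indep variable_moments (peak_monomials_dom rn)).
  rewrite -big_seq /peak_monomials big_map big_filter.
  by rewrite big_mkcondr mulr_suml.
under eq_fun do rewrite EY.
apply: cvg_sum_seq => s sk /eqP ds.
move: sk; rewrite mem_step_seqs => /andP[/eqP sk s3].
rewrite /limit_weight; set t := edges (- height s) s.
have lim := @cvg_prod_seq R _ (undup t) (fun e n =>
  (\int[P]_w (X (var_index (e.1, n.+1%:Z + e.2)) w ^+ count_mem e t)) /
     (n.+1%:R `^ alpha) ^+ count_mem e t)
  (fun e => if e.1 then 0 else m (count_mem e t)).
apply: cvg_trans (lim _); last first.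
  move=> e; rewrite mem_undup => et; apply: variable_moment_lim.
  by rewrite -has_count has_pred1.
apply: near_eq_cvg; near=> n.
have hdn : height s + depth s <= n%:Z.
  have : (`|(height s + depth s)%R| <= n)%N by near: n; exact: nbhs_infty_ge.
  lia.
rewrite /term hdn natr_powR_mul prodf_div.
have -> : \prod_(e <- undup t) (n.+1%:R `^ alpha) ^+ count_mem e t = (n.+1%:R `^ alpha) ^+ k :> R.
  rewrite (prodr_undup_exp_count t xpredT (fun _ => n.+1%:R `^ alpha)).
  by rewrite big_const_seq count_predT size_edges sk iter_mulr_1.
congr (_ / _).
have sD : {in mono n s, forall i, D i}.
  apply: (@peak_monomials_dom k n); apply: map_f.
  by rewrite mem_filter mem_step_seqs ds hdn sk s3 !eqxx.
rewrite (expectation_monomial indep variable_moments sD).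
have monoE : mono n s = map (fun e => var_index (e.1, n.+1%:Z + e.2)) t.
  by rewrite /mono edges_shift -map_comp.
have inj : {in t &, injective (fun e : bool * int => var_index (e.1, n.+1%:Z + e.2))}.
  move=> [x q] [y q'] /(edges_bounds s3) /= qb /(edges_bounds s3) /= q'b [-> qq'].
  by congr pair; move: qq'; lia.
rewrite monoE undup_map_in// big_map big_seq [RHS]big_seq.
apply: eq_bigr => e; rewrite mem_undup => et.
by rewrite (count_mem_map_in inj et).
Unshelve. all: by end_near. Qed.

Lemma trace_sum_law k :
  (\int[P]_w (\sum_(i < n) Y k i w)) / n%:R `^ (alpha * k%:R + 1) @[n --> \oo] -->
     (\sum_(s <- step_seqs k | displacement s == 0) limit_weight m s) / (alpha * k%:R + 1)
  /\ {ae P, forall w, (\sum_(i < n) Y k i w) / n%:R `^ (alpha * k%:R + 1) @[n --> \oo] -->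
     (\sum_(s <- step_seqs k | displacement s == 0) limit_weight m s) / (alpha * k%:R + 1)}.
Proof.
have [C HC] := peak_sum_sqr_le k.
apply: (@strong_law_polynomial_growth _ _ _ P (Y k) (alpha * k%:R) C _ k.*2) => //.
- by rewrite mulr_ge0// ltW.
- exact: integrable_peak_sum.
- exact: integrable_peak_sum_mul.
- exact: expectation_peak_sum_mul.
- exact: peak_sum_mean_lim.
Qed.

End tridiagonal_model.

Lemma scale_mx_exp {R : realType} (n k : nat) (c : R) (A : 'M[R]_n) :
  (c *: A) ^+ k = c ^+ k *: A ^+ k.
Proof.
elim: k => [|k IH]; first by rewrite !expr0 scale1r.
rewrite !exprS IH.
have -> : c *: A * (c ^+ k *: A ^+ k) = (c *: A) *m (c ^+ k *: A ^+ k) by [].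
by rewrite -scalemxAl -scalemxAr scalerA.
Qed.

Lemma ntrace_tridiag_pow {R : realType} (alpha : R) (d b : nat -> R) (n k : nat) :
  (0 < n)%N ->
  ntrace ((n%:R `^ (- alpha) *: tridiag d b n) ^+ k) =
  (\sum_(j < n) peak_sum d b k j) / n%:R `^ (alpha * k%:R + 1).
Proof.
move=> n0; rewrite /ntrace scale_mx_exp mxtraceZ mxtrace_tridiag_pow.
have nn0 : n%:R != 0 :> R by rewrite pnatr_eq0 -lt0n.
rewrite powRD; last by rewrite nn0 implybT.
rewrite powRr1 ?ler0n// powRrM powR_mulrn ?powR_ge0// invfM powRN exprVn.
by rewrite mulrA [LHS]mulrC [n%:R^-1 * _]mulrC.
Qed.

Theorem theorem1 (R : realType) (disp : measure_display)
  (T : measurableType disp) (P : probability T R) (alpha : R)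
  (d b : nat -> {RV P >-> R}) (m : nat -> R)
  (alpha_gt0 : 0 < alpha)
  (indep : independent_RVs [set i : bool * nat | (0 < i.2)%N]
             (fun i : bool * nat => if i.1 then d i.2 else b i.2))
  (m0 : m 0%N = 1)
  (b_finite : forall n k : nat, (0 < n)%N ->
     P.-integrable setT (fun w => (b n w ^+ k)%:E))
  (b_lim : forall k : nat,
     (fun n : nat => 'E_P[(fun w => ((b n w / n%:R `^ alpha) ^+ k)%R)]%E)
       @ \oo --> (m k)%:E)
  (d_bnd : forall k : nat,
     (ereal_sup [set 'E_P[(fun w => (`|d n w| ^+ k)%R)] | n in [set n | (0 < n)%N]]
        < +oo)%E) :
  let X (n : nat) (w : T) : 'M[R]_n :=
    n%:R `^ (- alpha) *: tridiag (fun j => d j w) (fun j => b j w) n in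
  (forall k : nat,
     (fun n : nat => 'E_P[(fun w => ntrace (X n w ^+ k)%R)]%E)
       @ \oo --> (limit_moment alpha m k)%:E)
  /\
  {ae P, forall w, forall k : nat,
     (fun n : nat => ntrace (X n w ^+ k)) @ \oo --> limit_moment alpha m k}.
Proof.
move=> X.
have law := trace_sum_law alpha_gt0 b_finite b_lim d_bnd indep.
have limE k : (\sum_(s <- step_seqs k | displacement s == 0) limit_weight m s) /
    (alpha * k%:R + 1) = limit_moment alpha m k.
  by rewrite limit_momentE// mulrC.
split=> [k|].
  have [meanlim _] := law k; rewrite limE in meanlim.
  have iS n : P.-integrable setT (fun w => ((\sum_(j < n)
      peak_sum (fun j => d j w) (fun j => b j w) k j) / n%:R `^ (alpha * k%:R + 1))%:E).
    under eq_fun do rewrite mulrC; apply: integrable_scale.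
    apply: integrable_bigsum => j _; exact: integrable_peak_sum.
  have EX n : (0 < n)%N -> 'E_P[(fun w => ntrace (X n w ^+ k)%R)]%E =
      (\int[P]_w ((\sum_(j < n) peak_sum (fun j => d j w) (fun j => b j w) k j) /
        n%:R `^ (alpha * k%:R + 1)))%:E.
    move=> n0; rewrite unlock /Rintegral fineK; last exact: integrable_fin_num (iS n).
    by apply: eq_integral => w _; rewrite ntrace_tridiag_pow.
  apply: cvg_EFin.
    by near=> n; rewrite EX//; near: n; exact: nbhs_infty_gt.
  apply: cvg_trans meanlim; apply: near_eq_cvg; near=> n.
  rewrite /= EX; last by near: n; exact: nbhs_infty_gt.
  rewrite /= RintegralZr//.
  apply: integrable_bigsum => j _; exact: integrable_peak_sum.
apply/ae_foralln => k.
have [_] := law k; apply: filterS => w; rewrite limE => wlim.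
apply: cvg_trans wlim; apply: near_eq_cvg; near=> n.
rewrite ntrace_tridiag_pow//; near: n; exact: nbhs_infty_gt.
Unshelve. all: by end_near. Qed.
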